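(* Let $\mu(d\theta,dx_1,\dots,dx_K)=\mu_0(d\theta)\prod_{k=1}^K\mathcal{M}_k(\theta,dx_k)$ be a partially-factorized probability distribution on $(\Theta\times S,\mathcal{T}\times\mathcal{S})$. For any $\varphi\in L^2_\mu$ and $N>0$, $$\mathrm{Var}(\mu^{M,N}_\times(\varphi))\leq\mathrm{Var}(\mu^{M,N}(\varphi))\quad\forall M>0,\qquad\sigma^2_{\times,N}(\varphi)\leq\sigma^2_N(\varphi),$$ where $$\mu^{M,N}_\times(\varphi):=\frac{1}{MN^K}\sum_{m=1}^M\sum_{\mathbf{n}\in[N]^K}\varphi(\theta^m,X^{m,\mathbf{n}}),\qquad\mu^{M,N}(\varphi):=\frac{1}{MN}\sum_{m=1}^M\sum_{n=1}^N\varphi(\theta^m,X^{m,n}),$$ and $\sigma^2_N(\varphi)$ denotes the asymptotic (in $M$) variance of $\mu^{M,N}(\varphi)$.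
   Context: $K>1$ is an integer, $[K]:=\{1,\dots,K\}$; $(\Theta,\mathcal{T})$ and $(S_k,\mathcal{S}_k)$, $k\in[K]$, are measurable spaces; $S:=S_1\times\dots\times S_K$ with product sigma-algebra $\mathcal{S}$. $\mu_0$ is a probability distribution on $(\Theta,\mathcal{T})$ and each $\mathcal{M}_k$ is a Markov kernel from $(\Theta,\mathcal{T})$ to $(S_k,\mathcal{S}_k)$. For $A\subseteq[K]$, $\mathcal{M}_A(\theta,dx_A):=\prod_{k\in A}\mathcal{M}_k(\theta,dx_k)$ and $\mathcal{M}:=\mathcal{M}_{[K]}$; $\mathcal{M}_A\varphi$ denotes the function of $\theta$ and $(x_k)_{k\notin A}$ obtained by integrating out $(x_k)_{k\in A}$ from $\varphi(\theta,x)$ with respect to $\mathcal{M}_A(\theta,dx_A)$ ($\mathcal{M}_\emptyset\varphi:=\varphi$); partial integrals are assumed well-defined at every point. $\mu(\varphi):=\int\varphi\,d\mu$; $L^2_\mu$ is the space of square $\mu$-integrable real-valued functions. For fixed $N$, the tuples $(\theta^m,X^{m,1},\dots,X^{m,N})$, $m=1,2,\dots$, are i.i.d., with $\theta^m\sim\mu_0$ and, conditionally on $\theta^m$, $X^{m,1},\dots,X^{m,N}$ i.i.d. with law $\mathcal{M}(\theta^m,\cdot)$. For $\mathbf{n}=(n_1,\dots,n_K)\in[N]^K$, $X^{m,\mathbf{n}}:=(X^{m,n_1}_1,\dots,X^{m,n_K}_K)$. The asymptotic variance of $\mu^{M,N}_\times(\varphi)$ (variance of the Gaussian limit of $M^{1/2}[\mu^{M,N}_\times(\varphi)-\mu(\varphi)]$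 as $M\to\infty$) is $$\sigma^2_{\times,N}(\varphi):=\mu_0([\mathcal{M}\varphi-\mu(\varphi)]^2)+\sum_{\emptyset\neq A\subseteq[K]}\frac{1}{N^{|A|}}\sum_{B\subseteq A}(-1)^{|A|-|B|}\mu_0(\mathcal{M}_B[\mathcal{M}_{[K]\setminus B}\varphi-\mathcal{M}\varphi]^2),$$ and $\sigma^2_N(\varphi)$ is the variance of the Gaussian limit of $M^{1/2}[\mu^{M,N}(\varphi)-\mu(\varphi)]$ as $M\to\infty$ with $N$ fixed. *)

(* Defs.v *)
From HB Require Import structures.
From mathcomp Require Import all_boot all_order all_algebra.
From mathcomp Require Import all_classical all_reals all_analysis.

Set Implicit Arguments.
Unset Strict Implicit.
Unset Printing Implicit Defensive.

Import Order.TTheory GRing.Theory Num.Theory.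
Import numFieldNormedType.Exports.

Local Open Scope classical_set_scope.
Local Open Scope ring_scope.
Local Open Scope ereal_scope.

(* Finite products of a heterogeneous family of measurable spaces.  The alias
   [dprod] keeps the sigma-algebra below off bare dependent function types. *)
Definition dprod (I : finType) (d : I -> measure_display)
  (S : forall i, measurableType (d i)) : Type := forall i, S i.

Definition dprod_display (I : finType) (d : I -> measure_display) :
  measure_display.
Proof. exact: default_measure_display. Qed.

Section dprod_measurable.
Context (I : finType) (d : I -> measure_display)
  (S : forall i, measurableType (d i)).

Definition dprod_cylinder : set (set (dprod S)) :=
  [set Z | exists i, exists2 C : set (S i),
     measurable C & Z = [set x | C (x i)]].

HB.instance Definition _ := Pointed.copy (dprod S) (forall i, S i).

Let dprod0 : <<s dprod_cylinder >> set0.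
Proof. exact: sigma_algebra0. Qed.

Let dprodC A : <<s dprod_cylinder >> A -> <<s dprod_cylinder >> (~` A).
Proof. exact: sigma_algebraC. Qed.

Let dprodU (F : (set (dprod S))^nat) : (forall i, <<s dprod_cylinder >> (F i)) ->
  <<s dprod_cylinder >> (\bigcup_i F i).
Proof. exact: sigma_algebra_bigcup. Qed.

HB.instance Definition _ := @isMeasurable.Build (dprod_display d) (dprod S)
  <<s dprod_cylinder >> dprod0 dprodC dprodU.

Lemma measurable_fun_dprodP d' (T : measurableType d') (f : T -> dprod S) :
  measurable_fun setT f <-> forall i, measurable_fun setT (fun t => f t i).
Proof.
split=> [mf i _ C mC|mf].
  rewrite setTI -[X in measurable X](setTI (f @^-1` [set x | C (x i)])).
  by apply: mf => //; apply: sub_sigma_algebra; exists i, C.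
apply: (measurability _ (erefl : measurable = <<s dprod_cylinder >>)).
move=> _ [_ [i [C mC ->]] <-].
by have := mf i measurableT C mC.
Qed.

End dprod_measurable.

Section product_probability.
Context (R : realType) (I : finType) (d : I -> measure_display)
  (S : forall i, measurableType (d i)).

Definition dprod_set (i : I) (p : dprod S * S i) : dprod S :=
  eqtype.dfwith p.1 p.2.

Lemma measurable_dprod_set i : measurable_fun setT (@dprod_set i).
Proof.
apply/measurable_fun_dprodP => j; case: (eqVneq i j) => [<-|ij].
  rewrite [X in measurable_fun _ X](_ : _ = snd); first exact: measurable_snd.
  by apply/funext => p; rewrite /dprod_set eqtype.dfwith_in.
rewrite [X in measurable_fun _ X](_ : _ = (fun p => p.1 j)); last first.
  by apply/funext => p; rewrite /dprod_set eqtype.dfwith_out.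
by apply: (measurable_fun_dprodP (fst : dprod S * S i -> _)).1.
Qed.

HB.instance Definition _ i :=
  @isMeasurableFun.Build _ _ _ _ (@dprod_set i) (@measurable_dprod_set i).

Variable Q : forall i, probability (S i) R.

(* The coordinates listed in [s] are drawn independently from the [Q i]; the
   others are frozen at the default point. *)
Fixpoint prod_prob_seq (s : seq I) : probability (dprod S) R :=
  if s is i :: s' then distribution (prod_prob_seq s' \x Q i) (@dprod_set i)
  else \d_(point : dprod S).

Definition prod_prob : probability (dprod S) R := prod_prob_seq (enum I).

Lemma measurable_dprod_box (C : forall i, set (S i)) :
  (forall i, measurable (C i)) ->
  measurable [set x : dprod S | forall i, C i (x i)].
Proof.
move=> mC.
rewrite (_ : mkset _ = \bigcap_(i in [set: I]) [set x : dprod S | C i (x i)]).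
  apply: fin_bigcap_measurable => // i _.
  by apply: sub_sigma_algebra; exists i, (C i).
by apply/seteqP; split => [x h i _|x h i]; [exact: h|exact: (h i Logic.I)].
Qed.

Let prod_prob_seqE s (C : forall i, set (S i)) : uniq s ->
  (forall i, measurable (C i)) ->
  prod_prob_seq s [set x | forall i, C i (x i)] =
  \prod_i if i \in s then Q i (C i) else \d_(point : S i) (C i).
Proof.
elim: s C => [|i s IH] C /= + mC.
  move=> _; rewrite diracE; have [h|/existsNP[i Ci]] := pselect (forall i, C i point).
    by rewrite mem_set//= big1// => i _; rewrite diracE mem_set.
  have nC : ~ [set x : dprod S | forall j, C j (x j)] point by move=> /(_ i).
  rewrite (memNset nC).
  by rewrite (bigD1 i)//= diracE memNset// mul0e.
move=> /andP[si us].
pose C' := eqtype.dfwith C [set: S i].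
have mC' j : measurable (C' j).
  rewrite /C'; case: (eqVneq i j) => [<-|ij]; first by rewrite eqtype.dfwith_in.
  by rewrite eqtype.dfwith_out.
rewrite /distribution /pushforward.
rewrite (_ : _ @^-1` _ = [set x | forall j, C' j (x j)] `*` C i); last first.
  apply/seteqP; split => [[x y] /= h|[x y] /= [h Cy] j].
    split => [j|]; last by have := h i; rewrite /dprod_set eqtype.dfwith_in.
    rewrite /C'; case: (eqVneq i j) => [<-|ij]; first by rewrite eqtype.dfwith_in.
    by rewrite eqtype.dfwith_out//; have := h j; rewrite /dprod_set eqtype.dfwith_out.
  rewrite /dprod_set; case: (eqVneq i j) => [<-|ij]; first by rewrite eqtype.dfwith_in.
  by have := h j; rewrite /C' !eqtype.dfwith_out.
rewrite product_measure1E//; last exact: measurable_dprod_box.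
have := IH C' us mC'; rewrite /= => ->.
rewrite (bigD1 i)//= [RHS](bigD1 i)//= (negbTE si) mem_head.
rewrite [C' i]eqtype.dfwith_in diracT mul1e muleC; congr (_ * _).
apply: eq_bigr => j ji; rewrite inE (negbTE ji)/=.
by rewrite [C' j]eqtype.dfwith_out// eq_sym.
Qed.

Lemma prod_probE (C : forall i, set (S i)) : (forall i, measurable (C i)) ->
  prod_prob [set x | forall i, C i (x i)] = \prod_i Q i (C i).
Proof.
move=> mC; rewrite /prod_prob prod_prob_seqE ?enum_uniq//.
by apply: eq_bigr => i _; rewrite mem_enum.
Qed.

End product_probability.

Definition kernel_prob (R : realType) d d' (T : measurableType d)
    (Y : measurableType d') (k : R.-pker T ~> Y) (t : T) : set Y -> \bar R :=
  k t.

Section kernel_prob_instance.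
Context (R : realType) d d' (T : measurableType d) (Y : measurableType d').
Variables (k : R.-pker T ~> Y) (t : T).

HB.instance Definition _ := Measure.on (kernel_prob k t).
HB.instance Definition _ :=
  Measure_isProbability.Build _ _ _ (kernel_prob k t) (prob_kernel t).

End kernel_prob_instance.

(* nu(dt, dy) = mu0(dt) Q(t, dy) *)
Definition disintegrates (R : realType) d d' (T : measurableType d)
    (Y : measurableType d') (mu0 : probability T R) (Q : T -> probability Y R)
    (nu : set (T * Y) -> \bar R) : Prop :=
  forall (A : set T) (B : set Y), measurable A -> measurable B ->
    nu (A `*` B) = \int[mu0]_(t in A) Q t B.

Section partially_factorized.
Context (R : realType) (K : nat) dT (Theta : measurableType dT)
  (dS : 'I_K -> measure_display) (S : forall k, measurableType (dS k)).
Variables (mu0 : probability Theta R) (Mk : forall k, R.-pker Theta ~> S k).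

Definition sub_dprod (A : {set 'I_K}) : Type :=
  dprod (fun k : {k | k \in A} => S (val k)).

HB.instance Definition _ (A : {set 'I_K}) := Measurable.on (sub_dprod A).

Definition Mprod (t : Theta) : probability (dprod S) R :=
  prod_prob (fun k => kernel_prob (Mk k) t).

Definition Mprod_sub (A : {set 'I_K}) (t : Theta) :
    probability (sub_dprod A) R :=
  prod_prob (fun k : {k | k \in A} => kernel_prob (Mk (val k)) t).

Definition partially_factorized (mu : probability (Theta * dprod S)%type R) :
    Prop :=
  disintegrates mu0 Mprod mu.

(* coordinates in A taken from y, the others from x *)
Definition glue_coords (A : {set 'I_K}) (x : dprod S) (y : sub_dprod A) : dprod S :=
  fun k => if @idP (k \in A) is ReflectT kA then y (exist _ k kA) else x k.

(* A function of theta and (x_k)_{k \notin A} is represented as a function on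
   the whole space that does not depend on the coordinates in A. *)
Definition Mint (A : {set 'I_K}) (f : Theta * dprod S -> \bar R)
    (z : Theta * dprod S) : \bar R :=
  \int[Mprod_sub A z.1]_y f (z.1, glue_coords z.2 y).

Definition partial_integrals_defined (f : Theta * dprod S -> \bar R) : Prop :=
  forall (A : {set 'I_K}) (t : Theta) (x : dprod S),
    (Mprod_sub A t).-integrable setT (fun y => f (t, glue_coords x y)).

(* mu0(f) for f that does not depend on x, evaluated at an arbitrary x *)
Definition mu0_int (f : Theta * dprod S -> \bar R) : \bar R :=
  \int[mu0]_t f (t, point).

Definition sigma2_cross (mu : probability (Theta * dprod S)%type R) (N : nat)
    (phi : Theta * dprod S -> R) : \bar R :=
  let f := EFin \o phi in
  let Mf := Mint finset.setT f in
  mu0_int (fun z => (Mf z - 'E_mu[phi]) ^+ 2) +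
  \sum_(A : {set 'I_K} | A != finset.set0)
    ((N%:R ^+ #|A|)^-1)%:E *
    \sum_(B : {set 'I_K} | B \subset A)
      ((-1) ^+ (#|A| - #|B|))%:E *
      mu0_int (Mint B (fun z => (Mint (~: B)%SET f z - Mf z) ^+ 2)).

Section simulation.
Variables (N : nat) (dO : measure_display) (Omega : measurableType dO)
  (P : probability Omega R).

(* (theta, (X^n)_n) *)
Definition sample_space : Type :=
  Theta * dprod (fun _ : 'I_N => dprod S).

HB.instance Definition _ := Measurable.on sample_space.

Definition mutually_independent d (T : measurableType d)
    (W : nat -> {RV P >-> T}) : Prop :=
  forall (E : nat -> set T) (J : seq nat), (forall m, measurable (E m)) ->
    uniq J ->
    P (\bigcap_(m in [set` J]) W m @^-1` E m) =
    \prod_(m <- J) P (W m @^-1` E m).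

Definition sampling_scheme (W : nat -> {RV P >-> sample_space}) : Prop :=
  mutually_independent W /\
  forall m, disintegrates mu0
    (fun t => prod_prob (fun _ : 'I_N => Mprod t)) (distribution P (W m)).

Variables (W : nat -> Omega -> sample_space) (phi : Theta * dprod S -> R).

Definition mu_std (M : nat) (w : Omega) : R :=
  ((M * N)%:R^-1 * \sum_(m < M) \sum_(n < N) phi ((W m w).1, (W m w).2 n))%R.

Definition mu_cross (M : nat) (w : Omega) : R :=
  ((M * N ^ K)%:R^-1 * \sum_(m < M) \sum_(n : {ffun 'I_K -> 'I_N})
     phi ((W m w).1, fun k => (W m w).2 (n k) k))%R.

End simulation.

End partially_factorized.

(* [normal_prob 0 0] is not the Dirac mass at 0, hence the case distinction *)
Definition gaussian (R : realType) (s2 : R) :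
    probability (measurableTypeR R) R :=
  if s2 == 0%R then (\d_(0%R : measurableTypeR R) : probability _ R)
  else (normal_prob 0%R (Num.sqrt s2) : probability _ R).

(* M^(1/2) (est M - m) converges in distribution to N(0, s2) *)
Definition asymptotic_variance (R : realType) d (Omega : measurableType d)
    (P : probability Omega R) (est : nat -> Omega -> R) (m s2 : R) : Prop :=
  (0 <= s2)%R /\
  forall g : R -> R, continuous g -> (exists C : R, forall x, (`|g x| <= C)%R) ->
    'E_P[fun w => g (Num.sqrt M%:R * (est M w - m))%R] @[M --> \oo] -->
    \int[gaussian s2]_x (g x)%:E.

(* Main.v *)
Require Import Defs.
From mathcomp Require Import all_boot all_order all_algebra.
From mathcomp Require Import all_classical all_reals all_analysis.
From mathcomp Require Import measurable_realfun giry kernel.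
From mathcomp Require Import ring lra.

(** The two inequalities rest on one symmetry.  Given theta, the entries
    X^i_k of the N copies are independent and the law of X^i_k depends on k
    only, so permuting, for each coordinate k separately, the copies that
    supply that coordinate leaves the law of a draw unchanged.  Take the cyclic
    shifts i |-> i + s_k, with s ranging over the functions from [K] to Z/N.
    The crossed average over all multi-indices is the mean over s of the
    standard average evaluated at the shifted copies ([cross_avg_shift]),
    because every multi-index is, for each i, the constant index i plus exactly
    one shift.  Shifts preserve the law ([transports_shift_copies],
    [transports_shift_draws]) and the square is convex, hence averaging over
    them cannot increase a variance ([variance_average_le]); this is the first
    inequality, [variance_cross_le].

    For the asymptotic variances let v be the second moment of the error
    N^-1 sum_i phi(theta, X^i) - mu(phi) of a single draw.

    The quantity sigma^2_(x,N)(phi) is at most v ([sigma2_cross_le]).  Fix theta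
    with phi(theta, .) square integrable and let psi be phi(theta, .) minus its
    mean.  In the expansion of (N^-K sum_n psi(X^n))^2 the expectation of
    psi(X^n) psi(X^n') depends only on the set B of coordinates where n and n'
    agree: given the coordinates in B the other ones are independent, and the
    expectation is M_B[(M_(B^c) psi)^2] ([pick_pair_law], [part_energyE]).
    Counting the pairs (n, n') by their agreement set and inverting over
    subsets ([sum_agree]) turns the sum into the alternating sum that defines
    sigma^2_(x,N) ([integral_cross_avg_sqr]).  The shift argument, now for fixed
    theta, bounds it by the second moment of the standard average
    ([anova_sum_le]); integrating over theta gives the claim
    ([integral_anova_given_le]).

    Finally v is at most the variance s2 of any Gaussian limit law
    ([std_error_variance_le]).  Only this half of the central limit theorem is
    needed, and it follows by testing the convergence with x |-> cos(t x).  The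
    mean of the cosine of t times the normalised error is at most the modulus
    of a characteristic function; by independence the square of this modulus is
    the M-th power of its one-draw version at t / sqrt M
    ([sqnorm_charfun_sum_draws]), whose limit is exp(- t^2 v)
    ([cvg_nat_sqnorm_charfun_sub1], [sqnorm_charfun_power_limit]).  The limit
    law satisfies E cos(t G) >= 1 - t^2 s2 / 2 ([gaussian_cos_ge]), and
    comparing the two bounds to second order at t = 0 gives v <= s2
    ([le_of_gaussian_bound]).

    Every law in play is identified by its values on boxes, the sets that
    constrain each coordinate separately ([eq_prob_box]). *)

Set Implicit Arguments.
Unset Strict Implicit.
Unset Printing Implicit Defensive.

Import Order.TTheory GRing.Theory Num.Theory.
Import numFieldNormedType.Exports.

Local Open Scope classical_set_scope.
Local Open Scope ring_scope.
Local Open Scope ereal_scope.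

(** * Subsets, agreement sets and averages *)

Section moebius.
Local Open Scope ring_scope.
Context (R : comPzRingType) (I : finType).
Implicit Types (A B C : {set I}) (H : {set I} -> R).

(** The signed sum is the expansion over subsets A of a product
    of sums F i + G i, where F i is the contribution of i when i belongs to A
    and G i the one when it does not; a point of B outside C contributes
    -1 + 1 = 0. *)
Lemma sum_sign_interval B C : C \subset B ->
  \sum_(A : {set I} | (C \subset A) && (A \subset B)) (-1) ^+ (#|A| - #|C|) =
  (B == C)%:R :> R.
Proof.
move=> CB.
pose F (i : I) : R := if i \in C then 1 else if i \in B then -1 else 0.
pose G (i : I) : R := if i \in C then 0 else 1.
transitivity (\prod_i (F i + G i)); last first.
  have [BC|BC] := eqVneq B C.
    by rewrite big1// => i _; rewrite /F /G BC; case: (i \in C); rewrite ?addr0 ?add0r.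
  have /subsetPn[i iB iC] : ~~ (B \subset C).
    by apply: contra BC => BC; rewrite finset.eqEsubset BC.
  by rewrite (bigD1 i)//= /F /G (negbTE iC) iB addNr mul0r.
rewrite finset.bigA_distr big_mkcond/=; apply: eq_bigr => A _.
have [CA|/subsetPn[i iC iA]] := boolP (C \subset A); last first.
  by rewrite (bigD1 i)//= (negbTE iA) /G iC mul0r.
have [AB|/subsetPn[i iA iB]] := boolP (A \subset B); last first.
  rewrite (bigD1 i)//= iA /F (negbTE iB).
  by rewrite (negbTE (contra (fintype.subsetP CB i) iB)) mul0r.
rewrite /= -finset.cardsDS// -prodr_const [RHS](bigID (mem (A :\: C)%SET))/=.
rewrite [X in _ = _ * X]big1 ?mulr1.
  apply: eq_bigr => i; rewrite finset.inE => /andP[iC iA].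
  by rewrite iA /F (negbTE iC) (fintype.subsetP AB).
move=> i; rewrite finset.inE negb_and negbK /F /G.
by case: (boolP (i \in C)) => [iC _|iC /= /negbTE ->//]; rewrite (fintype.subsetP CA).
Qed.

(** Exchanging the two sums leaves, for each C, the signed count of
    the sets between C and B, which vanishes unless C = B. *)
Lemma moebius_inversion H B :
  \sum_(A : {set I} | A \subset B) \sum_(C : {set I} | C \subset A)
    (-1) ^+ (#|A| - #|C|) * H C = H B.
Proof.
rewrite (exchange_big_dep (fun C : {set I} => C \subset B))/=; last first.
  by move=> A C AB CA; exact: fintype.subset_trans AB.
under eq_bigr => C CB.
  rewrite -mulr_suml (eq_bigl (fun A : {set I} => (C \subset A) && (A \subset B))).
    rewrite sum_sign_interval//; over.
  by move=> A; rewrite andbC.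
rewrite (bigD1 B)//= eqxx mul1r big1 ?addr0// => C /andP[_ CB].
by rewrite eq_sym (negbTE CB) mul0r.
Qed.

End moebius.

Section agreement.
Local Open Scope ring_scope.
Context (R : comPzRingType) (I L : finType).
Implicit Types (n : {ffun I -> L}).

Lemma card_agree_superset n (A : {set I}) :
  #|[set n' : {ffun I -> L} | A \subset [set i | n i == n' i]]%SET| =
  (#|L| ^ (#|I| - #|A|))%N.
Proof.
pose F (i : I) : pred L := if i \in A then pred1 (n i) else predT.
rewrite (@eq_card _ _ (mem (family F))); last first.
  move=> n'; rewrite finset.inE; apply/fintype.subsetP/familyP => [h i|h i iA].
    by rewrite /F; case: ifP => // /h; rewrite !inE eq_sym.
  by have := h i; rewrite /F iA !inE eq_sym.
rewrite card_family.
rewrite (_ : foldr _ _ _ = \prod_i #|F i|)%N; last first.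
  by rewrite foldrE big_image.
rewrite (bigID (mem A))/= big1 ?mul1n; last first.
  by move=> i iA; rewrite /F iA card1.
rewrite (eq_bigr (fun=> #|L|)); last by move=> i iA; rewrite /F (negbTE iA).
rewrite prod_nat_const; congr (_ ^ _)%N.
rewrite -[in RHS](finset.cardsC A) addKn -finset.cardsE.
by apply: eq_card => i; rewrite !finset.inE.
Qed.

(** Once H is written as the sum of its Moebius coefficients over the
    subsets A of the agreement set, A only asks n and n' to agree at least on
    A: n is free and so are the entries of n' outside A.  Unlike exact
    agreement, this count is a plain power of #|L|. *)
Lemma sum_agree (H : {set I} -> R) :
  \sum_(n : {ffun I -> L}) \sum_(n' : {ffun I -> L}) H [set i | n i == n' i]%SET =
  \sum_(A : {set I}) (#|L| ^ #|I| * #|L| ^ (#|I| - #|A|))%:R *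
    \sum_(C : {set I} | C \subset A) (-1) ^+ (#|A| - #|C|) * H C.
Proof.
under eq_bigr => n _ do under eq_bigr => n' _ do rewrite -moebius_inversion big_mkcond/=.
under eq_bigr => n _ do rewrite exchange_big/=.
rewrite exchange_big/=; apply: eq_bigr => A _.
rewrite (eq_bigr (fun=> (#|L| ^ (#|I| - #|A|))%:R *
   \sum_(C : {set I} | C \subset A) (-1) ^+ (#|A| - #|C|) * H C)).
  by rewrite sumr_const card_ffun natrM -[LHS]mulr_natl mulrA.
move=> n _; rewrite -big_mkcond/= sumr_const -(card_agree_superset n A).
by rewrite mulr_natl finset.cardsE.
Qed.

End agreement.

Section averages.
Local Open Scope ring_scope.
Context (R : realFieldType) (I : finType).

(** The difference of the two sides is the empirical variance of
    a. *)
Lemma sqr_average_le (a : I -> R) : (0 < #|I|)%N ->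
  (#|I|%:R^-1 * \sum_i a i) ^+ 2 <= #|I|%:R^-1 * \sum_i a i ^+ 2.
Proof.
move=> I0; set m := #|I|%:R^-1 * _.
have I0' : #|I|%:R != 0 :> R by rewrite pnatr_eq0 -lt0n.
have mE : \sum_i a i = #|I|%:R * m by rewrite /m mulVKf.
have : 0 <= #|I|%:R^-1 * \sum_i (a i - m) ^+ 2.
  by rewrite mulr_ge0 ?invr_ge0// sumr_ge0// => i _; exact: sqr_ge0.
rewrite (eq_bigr (fun i => a i ^+ 2 + (- (2 * m)) * a i + m ^+ 2)); last first.
  by move=> i _; ring.
clearbody m; rewrite !big_split/= -mulr_sumr sumr_const -[m ^+ 2 *+ _]mulr_natl mE => h.
rewrite -subr_ge0; apply: (le_trans h).
rewrite [X in X <= _](_ : _ = #|I|%:R^-1 * \sum_i a i ^+ 2 - m ^+ 2)//.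
by move: (#|I|%:R) I0' (\sum_i a i ^+ 2) => n n0 q; field.
Qed.

End averages.

(** * Laws determined by boxes *)

Section boxes.
Context d (T : measurableType d) (J : finType) (dU : J -> measure_display)
  (U : forall j, measurableType (dU j)) (p : forall j, T -> U j).

Definition box (C : forall j, set (U j)) : set T :=
  [set x | forall j, C j (p j x)].

Definition boxes : set (set T) :=
  [set A | exists2 C : forall j, set (U j), (forall j, measurable (C j)) &
     A = box C].

(** The sigma-algebra of T is the one generated by the maps p j, in
    the form of its universal property.  This form holds by composition for
    products, for products of products and for pairs of products, so that the
    lemmas on boxes below apply to all three. *)
Definition jointly_generating :=
  (forall j, measurable_fun setT (p j)) /\
  forall d' (T' : measurableType d') (f : T' -> T),
    (forall j, measurable_fun setT (p j \o f)) -> measurable_fun setT f.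

Hypothesis gen : jointly_generating.

Lemma setI_closed_boxes : setI_closed boxes.
Proof.
move=> _ _ [C mC ->] [D mD ->]; exists (fun j => C j `&` D j).
  by move=> j; exact: measurableI.
by apply/seteqP; split => [x [xC xD] j|x xCD]; [split; [exact: xC|exact: xD]|
  split => j; have [] := xCD j].
Qed.

Lemma boxes_setT : boxes setT.
Proof. by exists (fun=> setT) => //; apply/seteqP; split. Qed.

Lemma measurable_box C : (forall j, measurable (C j)) -> measurable (box C).
Proof.
move=> mC; rewrite (_ : box C = \bigcap_(j in [set: J]) (p j @^-1` C j)).
  apply: fin_bigcap_measurable => // j _.
  by rewrite -[X in measurable X]setTI; exact: gen.1.
by apply/seteqP; split => [x h j _|x h j]; [exact: h|exact: (h j Logic.I)].
Qed.

(** The inclusion that needs an argument says that the identity,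
    from T with the sigma-algebra generated by boxes to T, is measurable; the
    universal property reduces this to one coordinate at a time. *)
Lemma measurable_boxesE : @measurable _ T = <<s boxes >>.
Proof.
apply/seteqP; split => [A mA|]; last first.
  apply: smallest_sub; first exact: sigma_algebra_measurable.
  by move=> _ [C mC ->]; exact: measurable_box.
have mid : measurable_fun setT (id : g_sigma_algebraType boxes -> T).
  apply: gen.2 => j _ C mC; rewrite setTI.
  apply: sub_sigma_algebra.
  (* A constraint on coordinate j alone is a box. *)
  pose D := @eqtype.dfwith J (fun j => set (U j)) (fun=> setT) j C.
  exists D.
    move=> i; rewrite /D; have [<-|ji] := eqVneq j i.
      by rewrite eqtype.dfwith_in.
    by rewrite eqtype.dfwith_out.
  apply/seteqP; split => [x /= Cx i|x /(_ j)]; last first.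
    by rewrite /D eqtype.dfwith_in.
  rewrite /D; have [<-|ji] := eqVneq j i; first by rewrite eqtype.dfwith_in.
  by rewrite eqtype.dfwith_out.
by have := mid measurableT A mA; rewrite setTI.
Qed.

(** Boxes are stable under intersection, so two probabilities that
    agree on them agree everywhere. *)
Lemma eq_prob_box (R : realType) (m1 m2 : probability T R) :
  (forall C, (forall j, measurable (C j)) -> m1 (box C) = m2 (box C)) ->
  forall A, measurable A -> m1 A = m2 A.
Proof.
move=> m12 A mA.
apply: (@measure_unique _ _ _ boxes (fun=> setT)) => //.
- exact: measurable_boxesE.
- exact: setI_closed_boxes.
- by move=> _; exact: boxes_setT.
- by apply/seteqP; split => // x _; exists 0%N.
- by move=> _ [C mC ->]; exact: m12.
- by move=> _; rewrite (le_lt_trans (probability_le1 _ _)) ?ltry.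
Qed.

(** The sets with a measurable probability form a Dynkin class, and
    boxes are stable under intersection. *)
Lemma measurable_prob_box (R : realType) d' (X : measurableType d')
    (k : X -> probability T R) :
  (forall C, (forall j, measurable (C j)) ->
     measurable_fun setT (fun t => k t (box C))) ->
  forall A, measurable A -> measurable_fun setT (fun t => k t A).
Proof.
move=> kC; rewrite measurable_boxesE; apply: dynkin_induction.
- exact: measurable_boxesE.
- exact: setI_closed_boxes.
- under eq_fun do rewrite probability_setT.
  exact: measurable_cst.
- by move=> _ [C mC ->]; exact: kC.
- move=> A mA kA; under eq_fun do rewrite probability_setC//.
  exact: emeasurable_funB.
- move=> F mF tF kF.
  apply: (eq_measurable_fun (fun t => \sum_(0 <= n <oo) k t (F n))).
    by move=> t _; rewrite measure_semi_bigcup//; exact: bigcup_measurable.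
  exact: ge0_emeasurable_sum.
Qed.

End boxes.

Lemma jointly_generating_dprod (I : finType) (d : I -> measure_display)
    (S : forall i, measurableType (d i)) :
  jointly_generating (fun i (x : dprod S) => x i).
Proof.
split=> [i|d' T' f mf]; last exact/measurable_fun_dprodP.
exact: (measurable_fun_dprodP (id : dprod S -> _)).1.
Qed.

Lemma jointly_generating_nested (L I : finType) (d : I -> measure_display)
    (S : forall i, measurableType (d i)) :
  jointly_generating (fun (li : L * I) (x : dprod (fun _ : L => dprod S)) =>
    x li.1 li.2).
Proof.
split=> [[l i]|d' T' f mf].
  exact: (measurableT_comp ((jointly_generating_dprod S).1 i)
    ((jointly_generating_dprod (fun _ : L => dprod S)).1 l)).
apply/measurable_fun_dprodP => l; apply/measurable_fun_dprodP => i.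
exact: (mf (l, i)).
Qed.

Lemma jointly_generating_pair (I : finType) (d : I -> measure_display)
    (S : forall i, measurableType (d i)) :
  jointly_generating (fun (bi : bool * I) (z : dprod S * dprod S) =>
    (if bi.1 then z.1 else z.2) bi.2).
Proof.
split=> [[[] i]|d' T' f mf].
- exact: (measurableT_comp ((jointly_generating_dprod S).1 i) measurable_fst).
- exact: (measurableT_comp ((jointly_generating_dprod S).1 i) measurable_snd).
- apply/measurable_fun_pairP; split; apply/measurable_fun_dprodP => i.
    exact: (mf (true, i)).
  exact: (mf (false, i)).
Qed.

Section selection.
Context (R : realType) (I : finType) (d : I -> measure_display)
  (S : forall i, measurableType (d i)) (Q : forall i, probability (S i) R)
  (L J : finType).

Local Notation nested L := (dprod (fun _ : L => dprod S)).
Local Notation iid L := (prod_prob (fun _ : L => prod_prob Q)).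

(** A recombination of copies: coordinate i of the new copy j is read from
    the old copy nu j i.  Shifted copies and pairs of crossed points are both of
    this form. *)
Definition select (nu : J -> I -> L) (x : nested L) : nested J :=
  fun j i => x (nu j i) i.

Lemma measurable_select nu : measurable_fun setT (select nu).
Proof.
apply: (jointly_generating_nested _ _).2 => -[j i].
exact: ((jointly_generating_nested L S).1 (nu j i, i)).
Qed.

Lemma iid_boxE (C : forall l i, set (S i)) :
  (forall l i, measurable (C l i)) ->
  iid L [set x | forall l i, C l i (x l i)] = \prod_i \prod_l Q i (C l i).
Proof.
move=> mC; rewrite (prod_probE _ (C := fun l => [set x : dprod S | forall i, C l i (x i)])).
  by rewrite exchange_big/=; apply: eq_bigr => l _; rewrite prod_probE.
by move=> l; exact: measurable_dprod_box.
Qed.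

(** The entry (l, i) must meet the constraints of all the new copies
    j that read it. *)
Lemma iid_select_boxE (nu : J -> I -> L) (C : forall j i, set (S i)) :
  (forall j i, measurable (C j i)) ->
  iid L [set x | forall j i, C j i (x (nu j i) i)] =
  \prod_i \prod_l Q i [set s | forall j, nu j i = l -> C j i s].
Proof.
move=> mC; rewrite -iid_boxE.
  congr (_ _); apply/seteqP; split=> [x xC l i j <-|x xC j i]; first exact: xC.
  exact: xC.
move=> l i; rewrite (_ : mkset _ = \bigcap_(j in [set j | nu j i = l]) C j i).
  by apply: fin_bigcap_measurable => //; exact: finite_finset.
by apply/seteqP; split.
Qed.

End selection.

Section product_of_fibres.
Context (R : realType) (d : measure_display) (S : measurableType d)
  (Q : probability S R) (L J : finType).

(** Each l is hit by at most one j, so its factor is either the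
    probability of a single constraint or 1. *)
Lemma prod_prob_fibre_inj (f : J -> L) (C : J -> set S) : injective f ->
  \prod_l Q [set s | forall j, f j = l -> C j s] = \prod_j Q (C j).
Proof.
move=> finj; rewrite (bigID (fun l => l \in codom f))/= [X in _ * X]big1 ?mule1.
  rewrite -big_uniq/=; last by rewrite map_inj_uniq ?enum_uniq.
  rewrite big_image/=; apply: eq_bigr => j _; congr (_ _).
  apply/seteqP; split=> [s /(_ _ erefl)//|s Cs i].
  by move=> /finj ->.
move=> l lf; rewrite (_ : mkset _ = setT) ?probability_setT//.
apply/seteqP; split=> // s _ j jl.
by move: lf; rewrite -jl codom_f.
Qed.

End product_of_fibres.

Section selection_laws.
Context (R : realType) (I : finType) (d : I -> measure_display)
  (S : forall i, measurableType (d i)) (Q : forall i, probability (S i) R)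
  (L : finType).

Local Notation nested L := (dprod (fun _ : L => dprod S)).
Local Notation iid L := (prod_prob (fun _ : L => prod_prob Q)).

(** When, coordinate by coordinate, no entry is read twice, the new
    copies are built from distinct independent entries with the right laws, and
    are again independent and identically distributed. *)
Lemma iid_select_inj (J : finType) (nu : J -> I -> L) A :
  (forall i, injective (nu ^~ i)) -> measurable A ->
  iid L (select nu @^-1` A) = iid J A.
Proof.
move=> nuinj mA.
have mnu : measurable_fun setT (select nu : nested L -> nested J).
  exact: measurable_select.
pose X : {mfun nested L >-> nested J} := mfun_Sub (mem_set mnu).
refine (eq_prob_box (jointly_generating_nested J S)
  (m1 := distribution (iid L) X) (m2 := iid J) _ mA) => C mC.
rewrite /distribution /pushforward/=.
transitivity (iid L [set x | forall j i, C (j, i) (x (nu j i) i)]).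
  congr (prod_prob _ _); apply/seteqP.
  by split=> [x h j i|x h [j i]]; [exact: (h (j, i))|exact: h].
rewrite (iid_select_boxE Q nu (fun j i => mC (j, i)))//.
transitivity (iid J [set x | forall j i, C (j, i) (x j i)]); last first.
  congr (prod_prob _ _); apply/seteqP.
  by split=> [x h [j i]|x h j i]; [exact: h|exact: (h (j, i))].
rewrite (iid_boxE Q (fun j i => mC (j, i)))//; apply: eq_bigr => i _.
by rewrite (prod_prob_fibre_inj (Q i) (fun j => C (j, i)) (nuinj i)).
Qed.

End selection_laws.

(** * Glued coordinates and the law of a pair of recombined points *)

Section glue.
Context (K : nat) (dS : 'I_K -> measure_display)
  (S : forall k, measurableType (dS k)).
Implicit Types A B : {set 'I_K}.

Lemma glue_in A (x : dprod S) (y : sub_dprod S A) k (kA : k \in A) :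
  glue_coords x y k = y (exist _ k kA).
Proof.
rewrite /glue_coords; destruct idP as [h|h]; last by [].
by rewrite (bool_irrelevance h kA).
Qed.

Lemma glue_out A (x : dprod S) (y : sub_dprod S A) k : k \notin A ->
  glue_coords x y k = x k.
Proof. by rewrite /glue_coords; destruct idP as [h|h]; rewrite ?h. Qed.

Lemma measurable_glue A :
  measurable_fun setT (fun p : dprod S * sub_dprod S A => glue_coords p.1 p.2).
Proof.
apply/measurable_fun_dprodP => k; have [kA|kA] := boolP (k \in A).
  apply: (eq_measurable_fun (fun t : dprod S * sub_dprod S A =>
      t.2 (exist _ k kA))) => [t _|].
    by rewrite (glue_in _ _ kA).
  exact: (measurableT_comp ((jointly_generating_dprod
    (fun k : {k | k \in A} => S (val k))).1 (exist _ k kA)) measurable_snd).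
apply: (eq_measurable_fun (fun t : dprod S * sub_dprod S A => t.1 k)) => [t _|].
  by rewrite glue_out.
exact: (measurableT_comp ((jointly_generating_dprod S).1 k) measurable_fst).
Qed.

Context (R : realType) (Q : forall k, probability (S k) R).

Definition sub_prob A : probability (sub_dprod S A) R :=
  prod_prob (fun k : {k | k \in A} => Q (val k)).

Lemma sub_prob_box A (C : forall k, set (S k)) :
  (forall k, measurable (C k)) ->
  sub_prob A [set y | forall j : {k | k \in A}, C (val j) (y j)] =
  \prod_(k in A) Q k (C k).
Proof.
move=> mC.
have := @prod_probE R {k | k \in A} _ _ (fun k => Q (val k))
  (fun j => C (val j)) (fun j => mC (val j)).
rewrite /sub_prob => ->.
by rewrite (big_sub (fun k => k \in A) (fun k => Q k (C k))).
Qed.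

Lemma measurable_sub_box A (C : forall k, set (S k)) :
  (forall k, measurable (C k)) ->
  measurable ([set y | forall j : {k | k \in A}, C (val j) (y j)] :
    set (sub_dprod S A)).
Proof.
by move=> mC; apply: (@measurable_dprod_box _ _ _ (fun j => C (val j))).
Qed.

Definition join_coords B (p : sub_dprod S B * sub_dprod S (~: B)%SET) : dprod S :=
  glue_coords (glue_coords point p.1) p.2.

Lemma measurable_join_coords B : measurable_fun setT (@join_coords B).
Proof.
pose g (p : sub_dprod S B * sub_dprod S (~: B)%SET) : dprod S * sub_dprod S B :=
  (point, p.1).
have mg : measurable_fun setT g.
  apply/measurable_fun_pairP; split => /=; last exact: measurable_fst.
  exact: measurable_cst.
pose h (p : sub_dprod S B * sub_dprod S (~: B)%SET) :
  dprod S * sub_dprod S (~: B)%SET := (glue_coords point p.1, p.2).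
have mh : measurable_fun setT h.
  apply/measurable_fun_pairP; split => /=; last exact: measurable_snd.
  exact: (measurableT_comp (@measurable_glue B) mg).
exact: (measurableT_comp (@measurable_glue (~: B)%SET) mh).
Qed.

Lemma join_coords_in B p k (kB : k \in B) :
  @join_coords B p k = p.1 (exist _ k kB).
Proof. by rewrite /join_coords glue_out ?finset.inE ?kB// (glue_in _ _ kB). Qed.

Lemma join_coords_out B p k (kB : k \in (~: B)%SET) :
  @join_coords B p k = p.2 (exist _ k kB).
Proof. by rewrite /join_coords (glue_in _ _ kB). Qed.

(** Two points that share their coordinates in B; with independent
    arguments their coordinates outside B are independent. *)
Definition join_pair B
    (p : sub_dprod S B * (sub_dprod S (~: B)%SET * sub_dprod S (~: B)%SET)) :
    dprod S * dprod S :=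
  (join_coords (p.1, p.2.1), join_coords (p.1, p.2.2)).

Lemma measurable_join_pair B : measurable_fun setT (@join_pair B).
Proof.
pose T := (sub_dprod S B *
  (sub_dprod S (~: B)%SET * sub_dprod S (~: B)%SET))%type.
have m1 : measurable_fun setT (fun p : T => (p.1, p.2.1)).
  apply/measurable_fun_pairP; split => /=; first exact: measurable_fst.
  exact: (measurableT_comp measurable_fst measurable_snd).
have m2 : measurable_fun setT (fun p : T => (p.1, p.2.2)).
  apply/measurable_fun_pairP; split => /=; first exact: measurable_fst.
  exact: (measurableT_comp measurable_snd measurable_snd).
apply/measurable_fun_pairP; split.
- exact: (measurableT_comp (@measurable_join_coords B) m1).
- exact: (measurableT_comp (@measurable_join_coords B) m2).
Qed.

Context (L : finType).
Local Notation nested := (dprod (fun _ : L => dprod S)).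
Local Notation iid := (prod_prob (fun _ : L => prod_prob Q)).

Definition pick_coords (n : 'I_K -> L) (x : nested) : dprod S := fun k => x (n k) k.

Lemma measurable_pick_coords n : measurable_fun setT (pick_coords n).
Proof.
apply/measurable_fun_dprodP => k.
exact: ((jointly_generating_nested L S).1 (n k, k)).
Qed.

Definition pick_pair (n n' : 'I_K -> L) (x : nested) : dprod S * dprod S :=
  (pick_coords n x, pick_coords n' x).

Lemma measurable_pick_pair n n' : measurable_fun setT (pick_pair n n').
Proof. by apply/measurable_fun_pairP; split; exact: measurable_pick_coords. Qed.

Definition agree (n n' : 'I_K -> L) : {set 'I_K} := [set k | n k == n' k]%SET.

(** Both laws give every box the product over k of the same numbers: a
    coordinate on which n and n' agree is read once and must satisfy the
    constraints of both points, any other one is read from two different copies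
    and contributes the two probabilities separately. *)
Lemma pick_pair_law n n' (U : set (dprod S * dprod S)) : measurable U ->
  iid (pick_pair n n' @^-1` U) =
  (sub_prob (agree n n') \x
    (sub_prob (~: agree n n')%SET \x sub_prob (~: agree n n')%SET))
  (@join_pair (agree n n') @^-1` U).
Proof.
set B := agree n n' => mU.
pose X : {mfun nested >-> (dprod S * dprod S)%type} :=
  mfun_Sub (mem_set (measurable_pick_pair n n')).
pose Y : {mfun (sub_dprod S B *
    (sub_dprod S (~: B)%SET * sub_dprod S (~: B)%SET))%type >->
    (dprod S * dprod S)%type} :=
  mfun_Sub (mem_set (@measurable_join_pair B)).
refine (eq_prob_box (jointly_generating_pair S)
  (m1 := distribution iid X) (m2 := distribution (sub_prob B \x
    (sub_prob (~: B)%SET \x sub_prob (~: B)%SET)) Y) _ mU) => C mC.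
rewrite /distribution /pushforward/=.
(* The pair is a recombination into copies indexed by booleans. *)
pose nu b k := if b then n k else n' k.
transitivity (iid [set x | forall b k, C (b, k) (x (nu b k) k)]).
  congr (prod_prob _ _); apply/seteqP.
  by split=> [x h b k|x h [[] k]];
    [move: (h (b, k)); case: b|exact: (h true)|exact: (h false)].
rewrite (iid_select_boxE Q nu (fun b k => mC (b, k))).
rewrite (_ : _ @^-1` _ =
  [set y | forall j : {k | k \in B},
     (C (true, val j) `&` C (false, val j)) (y j)] `*`
  ([set u | forall j : {k | k \in (~: B)%SET}, C (true, val j) (u j)] `*`
   [set u | forall j : {k | k \in (~: B)%SET}, C (false, val j) (u j)])); last first.
  apply/seteqP; split=> [[y [u u']] h|[y [u u']] [hy [hu hu']]].
    split=> [[k kB]|/=]; first split => /=.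
    - by have := h (true, k); rewrite /= (join_coords_in _ kB).
    - by have := h (false, k); rewrite /= (join_coords_in _ kB).
    - split=> -[k kB].
        by have := h (true, k); rewrite /= (join_coords_out _ kB).
      by have := h (false, k); rewrite /= (join_coords_out _ kB).
  move=> [b k]; have [kB|kB] := boolP (k \in B).
    have [/=] := hy (exist _ k kB).
    by case: b; rewrite /= (join_coords_in _ kB).
  have {}kB : k \in (~: B)%SET by rewrite finset.inE.
  have := hu (exist _ k kB); have := hu' (exist _ k kB).
  by case: b; rewrite /= (join_coords_out _ kB).
have mCt k : measurable (C (true, k) : set (S k)) := mC (true, k).
have mCf k : measurable (C (false, k) : set (S k)) := mC (false, k).
have mCI k : measurable ((C (true, k) : set (S k)) `&` C (false, k)).
  exact: measurableI.
have mIB := @measurable_sub_box B _ mCI.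
have mtB := @measurable_sub_box (~: B)%SET _ mCt.
have mfB := @measurable_sub_box (~: B)%SET _ mCf.
have E2 := product_measure1E (sub_prob (~: B)%SET) (sub_prob (~: B)%SET) mtB mfB.
pose P2 : probability (sub_dprod S (~: B)%SET * sub_dprod S (~: B)%SET)%type R :=
  (sub_prob (~: B)%SET \x sub_prob (~: B)%SET).
have E1 := product_measure1E (sub_prob B) P2 mIB (measurableX mtB mfB).
have E := etrans E1 (congr2 mule (sub_prob_box B mCI) (etrans E2
  (congr2 mule (sub_prob_box (~: B)%SET mCt) (sub_prob_box (~: B)%SET mCf)))).
apply: (etrans _ (esym E)) => {E E1 E2}.
rewrite -big_split/= (bigID (fun k => k \in B))/=; congr (_ * _).
  apply: eq_bigr => k; rewrite finset.inE => /eqP nk.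
  rewrite (bigD1 (n k))//= big1 ?mule1 => [|l ln].
    congr (Q k _); apply/seteqP; split=> [s h|s [h h'] []//].
    split; first exact: (h true erefl).
    by apply: (h false); rewrite /nu -nk.
  rewrite (_ : mkset _ = setT) ?probability_setT//.
  apply/seteqP; split=> // s _ b nul; move: ln; rewrite -nul /nu.
  by case: b {nul}; rewrite ?nk eqxx.
rewrite (eq_bigl (fun k => k \in (~: B)%SET)); last first.
  by move=> k; rewrite finset.in_setC.
apply: eq_bigr => k; rewrite !finset.inE => nk.
rewrite (prod_prob_fibre_inj (Q k) (fun b => C (b, k)) (f := nu ^~ k)).
  by rewrite big_bool.
by move=> [] [] //; rewrite /nu => /eqP; rewrite ?(negbTE nk)// eq_sym (negbTE nk).
Qed.

Lemma pick_coords_law n (U : set (dprod S)) : measurable U ->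
  iid (pick_coords n @^-1` U) = prod_prob Q U.
Proof.
move=> mU.
have mV : measurable ([set x | U (x tt)] : set (dprod (fun _ : unit => dprod S))).
  rewrite -[X in measurable X]setTI.
  exact: (jointly_generating_dprod (fun _ : unit => dprod S)).1.
have inj (i : 'I_K) : injective (fun _ : unit => n i) by move=> [] [].
have := iid_select_inj Q (nu := fun _ => n) inj mV.
rewrite /= => ->.
rewrite (_ : [set x | U (x tt)] = [set x | forall j : unit, U (x j)]); last first.
  by apply/seteqP; split=> [x h []|x /(_ tt)].
rewrite (prod_probE _ (C := fun _ : unit => U))//.
by rewrite (bigD1 tt)//= big1 ?mule1// => -[].
Qed.

Lemma glue_setT_law x (U : set (dprod S)) : measurable U ->
  sub_prob finset.setT (glue_coords x @^-1` U) = prod_prob Q U.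
Proof.
move=> mU.
have mg : measurable_fun setT
    (glue_coords x : sub_dprod S finset.setT -> dprod S).
  exact: (measurableT_comp (@measurable_glue finset.setT) (measurable_pair1 x)).
pose X : {mfun sub_dprod S finset.setT >-> dprod S} := mfun_Sub (mem_set mg).
refine (eq_prob_box (jointly_generating_dprod S)
  (m1 := distribution (sub_prob finset.setT) X) (m2 := prod_prob Q) _ mU) => C mC.
rewrite /distribution /pushforward/= (prod_probE _ mC).
rewrite -(eq_bigl _ _ (fun k => finset.in_setT k)) -(sub_prob_box finset.setT mC).
congr (sub_prob _ _); apply/seteqP; split=> [y h [k kT]|y h k].
  have : C k (glue_coords x y k) := h k.
  by rewrite (glue_in _ _ kT).
rewrite /= (glue_in _ _ (finset.in_setT k)).
exact: (h (exist _ k (finset.in_setT k))).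
Qed.

End glue.

(** * Kernels and disintegration *)

Lemma measurable_prod_prob (R : realType) (I : finType) (d : I -> measure_display)
    (S : forall i, measurableType (d i)) d' (X : measurableType d')
    (Q : X -> forall i, probability (S i) R) :
  (forall i U, measurable U -> measurable_fun setT (fun t => Q t i U)) ->
  forall U, measurable U -> measurable_fun setT (fun t => prod_prob (Q t) U).
Proof.
move=> mQ; apply: (measurable_prob_box (jointly_generating_dprod S)) => C mC.
apply: (eq_measurable_fun (fun t => \prod_i Q t i (C i))) => [t _|].
  by rewrite prod_probE.
elim: (index_enum I) => [|i s IH].
  by under eq_fun do rewrite big_nil; exact: measurable_cst.
under eq_fun do rewrite big_cons.
by apply: emeasurable_funM => //; exact: mQ.
Qed.

Section disintegration.
Context (R : realType) dT dY (T : measurableType dT) (Y : measurableType dY)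
  (mu0 : probability T R) (Q : T -> probability Y R).
Hypothesis mQ : forall U, measurable U -> measurable_fun setT (fun t => Q t U).

Let kappa (t : T) : giry (T * Y)%type R := giry_prod (giry_ret t, Q t : giry Y R).

Let measurable_kappa : measurable_fun setT kappa.
Proof.
have mQ' : measurable_fun setT (Q : T -> giry Y R).
  exact: measurable_giry_codensity.
apply: (measurableT_comp (measurable_giry_prod (R := R))).
by apply/measurable_fun_pairP; split => //=; exact: measurable_giry_ret.
Qed.

Let kappaE f t : measurable_fun setT f -> (forall z, 0 <= f z) ->
  giry_int (kappa t) f = \int[Q t]_y f (t, y).
Proof.
move=> mf f0; rewrite /kappa giry_int_prod1// giry_int_ret//.
exact: (measurable_fun_fubini_tonelli_F _ mf f0).
Qed.

Lemma measurable_fiber_integral f : measurable_fun setT f ->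
  (forall z, 0 <= f z) ->
  measurable_fun setT (fun t => \int[Q t]_y f (t, y)).
Proof.
move=> mf f0.
apply: (eq_measurable_fun (giry_int ^~ f \o kappa)) => [t _|].
  by rewrite /= kappaE.
by apply: (measurableT_comp _ measurable_kappa); exact: measurable_giry_int.
Qed.

Lemma measurable_fiber_integral_signed f : measurable_fun setT f ->
  measurable_fun setT (fun t => \int[Q t]_y f (t, y)).
Proof.
move=> mf.
have mp := measurable_fiber_integral (measurable_funepos mf) (funepos_ge0 f).
have mn := measurable_fiber_integral (measurable_funeneg mf) (funeneg_ge0 f).
apply: (eq_measurable_fun (fun t => \int[Q t]_y f^\+ (t, y) -
  \int[Q t]_y f^\- (t, y))) => [t _|].
    rewrite [RHS]integralE; congr (_ - _); apply: eq_integral => y _.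
      by rewrite !funeposE.
    by rewrite !funenegE.
exact: emeasurable_funB.
Qed.

(** On rectangles nu coincides with the mixture over mu0 of the
    laws of (t, y) with y drawn from Q t; for this mixture the formula is the
    bind law of the Giry monad. *)
Lemma integral_disintegrates (nu : probability (T * Y)%type R) f :
  disintegrates mu0 Q nu -> measurable_fun setT f -> (forall z, 0 <= f z) ->
  \int[nu]_z f z = \int[mu0]_t \int[Q t]_y f (t, y).
Proof.
move=> dnu mf f0.
pose bind := giry_bind (mu0 : giry T R) measurable_kappa.
transitivity (giry_int bind f); last first.
  rewrite /bind giry_int_bind// /giry_int; apply: eq_integral => t _.
  exact: kappaE.
apply: eq_measure_integral => A mA _.
pose G := [set A `*` B | A in @measurable _ T & B in @measurable _ Y].
apply: (@measure_unique _ _ _ G (fun=> setT)) => //.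
- by rewrite measurable_prod_measurableType.
- move=> _ _ [A1 mA1 [A2 mA2 <-]] [B1 mB1 [B2 mB2 <-]].
  exists (A1 `&` B1); first exact: measurableI.
  by exists (A2 `&` B2); [exact: measurableI|rewrite setXI].
- by move=> _; exists setT => //; exists setT => //; rewrite setXTT.
- by apply/seteqP; split => // x _; exists 0%N.
- move=> _ [C mC [D mD <-]]; rewrite [LHS]dnu//.
  have mCD : measurable (C `*` D) by exact: measurableX.
  rewrite -[in RHS](setIT (C `*` D)) -integral_indic//.
  rewrite [RHS](giry_int_bind (mu0 : giry T R) measurable_kappa); last 2 first.
  + exact/measurable_EFinP/measurable_indic.
  + by move=> z; rewrite lee_fin.
  rewrite integral_mkcond /giry_int; apply: eq_integral => t _.
  rewrite -[RHS]/(giry_int (kappa t) _) kappaE; last 2 first.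
  + exact/measurable_EFinP/measurable_indic.
  + by move=> z; rewrite lee_fin.
  rewrite patchE; case: ifPn => tC.
    rewrite -[D in LHS]setIT -integral_indic//; apply: eq_integral => y _.
    by rewrite /= !indicE in_setX tC.
  rewrite integral0_eq// => y _.
  by rewrite /= indicE in_setX (negbTE tC).
- by move=> _; rewrite (le_lt_trans (probability_le1 _ _)) ?ltry.
Qed.

End disintegration.

(** * Law-preserving maps and convexity *)

Section transports.
Context (R : realType) d d' (T : measurableType d) (T' : measurableType d')
  (P : probability T R) (P' : probability T' R) (h : T -> T').

(** P' is the image of P under h, as an equation on sets: h itself
    need not be packaged as a measurable function. *)
Definition transports := measurable_fun setT h /\
  forall U, measurable U -> P (h @^-1` U) = P' U.

Hypothesis hP : transports.

Let X : {mfun T >-> T'} := mfun_Sub (mem_set hP.1).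

Let lawE U : measurable U -> U `<=` setT -> P' U = distribution P X U.
Proof. by move=> mU _; rewrite -hP.2. Qed.

Lemma ge0_integral_transports f : measurable_fun setT f ->
  (forall y, 0 <= f y) -> \int[P]_x f (h x) = \int[P']_y f y.
Proof.
move=> mf f0; rewrite (eq_measure_integral _ lawE).
by rewrite ge0_integral_distribution.
Qed.

Lemma integrable_transports f : P'.-integrable setT f ->
  P.-integrable setT (fun x => f (h x)).
Proof.
move=> /integrableP[mf intf]; apply/integrableP; split.
  exact: (measurableT_comp mf hP.1).
by rewrite (ge0_integral_transports (f := abse \o f))//=; exact: measurableT_comp.
Qed.

Lemma integral_transports f : P'.-integrable setT f ->
  \int[P]_x f (h x) = \int[P']_y f y.
Proof.
move=> intf; rewrite (eq_measure_integral _ lawE).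
rewrite integral_distribution//; first exact: measurable_int intf.
exact: integrable_transports.
Qed.

End transports.

Lemma transports_coordinate (R : realType) (I : finType) (d : I -> measure_display)
    (S : forall i, measurableType (d i)) (Q : forall i, probability (S i) R) i :
  transports (prod_prob Q) (Q i) (fun x : dprod S => x i).
Proof.
split=> [|U mU]; first exact: (jointly_generating_dprod S).1.
pose C := @eqtype.dfwith I (fun j => set (S j)) (fun=> setT) i U.
have mC j : measurable (C j).
  rewrite /C; have [<-|ij] := eqVneq i j; first by rewrite eqtype.dfwith_in.
  by rewrite eqtype.dfwith_out.
rewrite (_ : _ @^-1` U = [set x : dprod S | forall j, C j (x j)]); last first.
  apply/seteqP; split=> [x Ux j|x /(_ i)]; last by rewrite /C eqtype.dfwith_in.
  rewrite /C; have [<-|ij] := eqVneq i j; first by rewrite eqtype.dfwith_in.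
  by rewrite eqtype.dfwith_out.
rewrite (prod_probE _ mC) (bigD1 i)//= big1 ?mule1 /C ?eqtype.dfwith_in// => j ji.
by rewrite eqtype.dfwith_out ?probability_setT// eq_sym.
Qed.

Section convexity.
Context (R : realType) d (T : measurableType d) (P : probability T R)
  (I : finType) (h : I -> T -> T).
Hypothesis hP : forall i, transports P P (h i).

(** Pointwise convexity of the square, and the invariance of P
    under each h i, which gives all the terms F (h i x) ^+ 2 the same
    integral. *)
Lemma integral_sqr_average_le (F : T -> R) : (0 < #|I|)%N ->
  measurable_fun setT F ->
  \int[P]_x ((#|I|%:R^-1 * \sum_i F (h i x)) ^+ 2)%:E <= \int[P]_x (F x ^+ 2)%:E.
Proof.
move=> I0 mF.
have mF2 : measurable_fun setT (fun x => (F x ^+ 2)%:E).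
  by apply/measurable_EFinP; exact: measurable_funX.
have mFh i : measurable_fun setT (fun x => F (h i x)).
  exact: (measurableT_comp mF (hP i).1).
apply: (@le_trans _ _ (\int[P]_x (#|I|%:R^-1 * \sum_i F (h i x) ^+ 2)%:E)).
  apply: ge0_le_integral => //.
  - by move=> x _; rewrite lee_fin sqr_ge0.
  - apply/measurable_EFinP; apply: measurable_funX; apply: measurable_funM => //.
    exact: measurable_sum.
  - apply/measurable_EFinP; apply: measurable_funM => //.
    by apply: measurable_sum => i; exact: measurable_funX.
  - by move=> x _; rewrite lee_fin sqr_average_le.
under eq_integral do rewrite EFinM -sumEFin.
have mFh2 i : measurable_fun setT (fun x => (F (h i x) ^+ 2)%:E).
  by apply/measurable_EFinP; exact: measurable_funX.
have Fh20 i x : setT x -> 0 <= (F (h i x) ^+ 2)%:E by rewrite lee_fin sqr_ge0.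
have ms := emeasurable_sum (index_enum I) mFh2.
rewrite (ge0_integralZl _ measurableT ms)//; last first.
  by move=> x _; apply: sume_ge0 => i _; exact: Fh20.
rewrite (ge0_integral_sum _ measurableT mFh2 Fh20).
rewrite (eq_bigr (fun=> \int[P]_x (F x ^+ 2)%:E)); last first.
  move=> i _; apply: (ge0_integral_transports (hP i) mF2).
  by move=> x; rewrite lee_fin sqr_ge0.
rewrite sumr_const -[X in _ * X]mule_natl muleA -EFinM mulVf ?mul1e//.
by rewrite pnatr_eq0 -lt0n.
Qed.

End convexity.

Section shifts.
Context (R : realType) (K : nat) (dS : 'I_K -> measure_display)
  (S : forall k, measurableType (dS k)) (Q : forall k, probability (S k) R)
  (N : nat).

Local Notation nested := (dprod (fun _ : 'I_N.+1 => dprod S)).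
Local Notation iid := (prod_prob (fun _ : 'I_N.+1 => prod_prob Q)).

(** Addition is that of Z/N, so that each coordinate is moved
    cyclically between the copies. *)
Definition shift_copies (s : {ffun 'I_K -> 'I_N.+1}) : nested -> nested :=
  select (fun i k => (i + s k)%R).

(** For fixed k the map i |-> i + s k is injective: no entry is
    read twice. *)
Lemma transports_shift_copies s : transports iid iid (shift_copies s).
Proof.
split=> [|U mU]; first exact: measurable_select.
by apply: iid_select_inj mU => k; exact: addIr.
Qed.

Definition std_avg (g : dprod S -> R) (x : nested) : R :=
  (N.+1%:R^-1 * \sum_i g (x i))%R.

Definition cross_avg (g : dprod S -> R) (x : nested) : R :=
  ((N.+1 ^ K)%:R^-1 * \sum_(n : {ffun 'I_K -> 'I_N.+1}) g (pick_coords n x))%R.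

Lemma cross_avg_shift g x :
  cross_avg g x = (#|{ffun 'I_K -> 'I_N.+1}|%:R^-1 *
    \sum_s std_avg g (shift_copies s x))%R.
Proof.
rewrite /cross_avg /std_avg card_ffun !card_ord -mulr_sumr exchange_big/=.
congr (_ * _)%R.
rewrite [X in _ = (_ * X)%R](eq_bigr
    (fun=> \sum_(n : {ffun 'I_K -> 'I_N.+1}) g (pick_coords n x))%R).
  by rewrite sumr_const card_ord -[X in _ = (_ * X)%R]mulr_natl mulKf// pnatr_eq0.
(* For each i, s |-> i + s is a bijection onto the multi-indices. *)
move=> i _; rewrite [RHS](reindex_inj (addrI [ffun=> i])).
by apply: eq_bigr => s _; congr g; apply: functional_extensionality_dep => k;
  rewrite /shift_copies /select /pick_coords !ffunE.
Qed.

End shifts.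

(** * The variance decomposition for fixed marginals *)

Lemma integrable_mul_sqr (R : realType) d (T : measurableType d)
    (P : probability T R) (f g : T -> R) :
  measurable_fun setT f -> measurable_fun setT g ->
  P.-integrable setT (fun x => (f x ^+ 2)%:E) ->
  P.-integrable setT (fun x => (g x ^+ 2)%:E) ->
  P.-integrable setT (fun x => (f x * g x)%:E).
Proof.
move=> mf mg f2 g2.
apply: (le_integrable measurableT _ _ (integrableD measurableT f2 g2)).
  by apply/measurable_EFinP; exact: measurable_funM.
move=> x _; rewrite /= lee_fin normrM [leRHS]ger0_norm; last first.
  by rewrite addr_ge0 ?sqr_ge0.
rewrite -(real_normK (num_real (f x))) -(real_normK (num_real (g x))).
have := sqr_ge0 (`|f x| - `|g x|); have := sqr_ge0 (`|f x| + `|g x|).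
by rewrite !sqrrD sqrrN mulrN; nra.
Qed.

Lemma integrable_sqr (R : realType) d (T : measurableType d)
    (P : probability T R) (f : T -> R) :
  measurable_fun setT f ->
  P.-integrable setT (fun x => (f x ^+ 2)%:E) ->
  P.-integrable setT (fun x => (f x)%:E).
Proof.
move=> mf f2.
have i1 : P.-integrable setT (fun x : T => (1 ^+ 2)%:E : \bar R).
  exact: finite_measure_integrable_cst.
have := integrable_mul_sqr mf (measurable_cst (1%R : R)) f2 i1.
by apply: eq_integrable => // x _; rewrite /cst mulr1.
Qed.

(** The cross term vanishes because f is centered. *)
Lemma integral_sqrD_cst (R : realType) d (T : measurableType d)
    (P : probability T R) (f : T -> R) (c : R) :
  measurable_fun setT f -> P.-integrable setT (fun x => (f x ^+ 2)%:E) ->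
  \int[P]_x (f x)%:E = 0 ->
  \int[P]_x ((f x + c) ^+ 2)%:E = \int[P]_x (f x ^+ 2)%:E + (c ^+ 2)%:E.
Proof.
move=> mf f2 f0; have f1 := integrable_sqr mf f2.
rewrite (_ : (fun x => _) = (fun x => (f x ^+ 2)%:E +
    ((2 * c)%:E * (f x)%:E + (c ^+ 2)%:E))); last first.
  by apply/funext => x; rewrite -EFinM -!EFinD; congr EFin; ring.
have ic : P.-integrable setT (fun x : T => (c ^+ 2)%:E : \bar R).
  exact: finite_measure_integrable_cst.
have iZ := integrableZl measurableT (2 * c) f1.
rewrite (integralD measurableT f2 (integrableD measurableT iZ ic)).
rewrite (integralD measurableT iZ ic) (integralZl measurableT f1) f0 mule0 add0e.
by have := expectation_cst P (c ^+ 2); rewrite unlock => ->.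
Qed.

Section integral_product.
Context (R : realType) d d' (T : measurableType d) (T' : measurableType d')
  (P : probability T R) (P' : probability T' R) (a : T -> R) (b : T' -> R).
Hypotheses (ia : P.-integrable setT (EFin \o a))
  (ib : P'.-integrable setT (EFin \o b)).

(** Fubini-Tonelli applied to the absolute value reduces
    integrability to the finiteness of the product of the two absolute first
    moments. *)
Lemma integrable_product :
  (P \x P').-integrable setT (fun p : T * T' => (a p.1 * b p.2)%:E).
Proof.
have ma : measurable_fun setT a.
  by apply/measurable_EFinP; exact: measurable_int ia.
have mb : measurable_fun setT b.
  by apply/measurable_EFinP; exact: measurable_int ib.
have mp : measurable_fun setT (fun p : T * T' => (a p.1 * b p.2)%:E).
  by apply/measurable_EFinP; apply: measurable_funM;
    [exact: (measurableT_comp ma measurable_fst)|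
     exact: (measurableT_comp mb measurable_snd)].
apply/(integrable12ltyP _ _ mp).
have [_ ia'] := integrableP _ _ _ ia.
have [_ ib'] := integrableP _ _ _ ib.
rewrite (eq_integral (fun x => `|(a x)%:E| * \int[P']_y `|(b y)%:E|)); last first.
  move=> x _; rewrite -ge0_integralZl//.
    by apply: eq_integral => y _; rewrite EFinM abseM.
  by apply: measurableT_comp => //; exact/measurable_EFinP.
rewrite ge0_integralZr//; last 2 first.
- by apply: measurableT_comp => //; exact/measurable_EFinP.
- exact: integral_ge0.
by rewrite lte_mul_pinfty// ?integral_ge0// ge0_fin_numE// integral_ge0.
Qed.

Lemma integral_product : \int[P \x P']_p (a p.1 * b p.2)%:E =
  (\int[P]_x (a x)%:E) * (\int[P']_y (b y)%:E).
Proof.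
have b_fin : \int[P']_y (b y)%:E \is a fin_num by exact: integrable_fin_num.
rewrite -(integral12_prod_meas1 integrable_product)/= /fubini_F/=.
rewrite (eq_integral (fun x => (a x)%:E * \int[P']_y (b y)%:E)); last first.
  by move=> x _; rewrite -integralZl//.
by rewrite -(fineK b_fin) integralZr// (fineK b_fin).
Qed.

End integral_product.

Section pair_integrals.
Context (R : realType) (K : nat) (dS : 'I_K -> measure_display)
  (S : forall k, measurableType (dS k)) (Q : forall k, probability (S k) R).
Variable psi : dprod S -> R.
Hypotheses (mpsi : measurable_fun setT psi)
  (psi2 : (prod_prob Q).-integrable setT (fun x => (psi x ^+ 2)%:E))
  (psi_def : forall A x,
    (sub_prob Q A).-integrable setT (fun y => (psi (glue_coords x y))%:E)).

(** M_(B^c) psi, for fixed theta. *)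
Definition part_mean (B : {set 'I_K}) (x : dprod S) : \bar R :=
  \int[sub_prob Q (~: B)%SET]_u (psi (glue_coords x u))%:E.

(** M_B[(M_(B^c) psi)^2], for fixed theta. *)
Definition part_energy (B : {set 'I_K}) : \bar R :=
  \int[sub_prob Q B]_y (part_mean B (glue_coords point y)) ^+ 2.

Section picks.
Context (L : finType).
Local Notation nested := (dprod (fun _ : L => dprod S)).
Local Notation iid := (prod_prob (fun _ : L => prod_prob Q)).
Implicit Types n : 'I_K -> L.

Lemma transports_pick n : transports iid (prod_prob Q) (pick_coords n).
Proof.
by split=> [|U mU]; [exact: measurable_pick_coords|exact: pick_coords_law].
Qed.

Lemma measurable_psi_pick n : measurable_fun setT (fun x => psi (pick_coords n x)).
Proof. exact: (measurableT_comp mpsi (measurable_pick_coords n)). Qed.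

Lemma integrable_pick_mul n n' :
  iid.-integrable setT (fun x => (psi (pick_coords n x) * psi (pick_coords n' x))%:E).
Proof.
apply: integrable_mul_sqr; try exact: measurable_psi_pick.
- exact: (integrable_transports (transports_pick n) psi2).
- exact: (integrable_transports (transports_pick n') psi2).
Qed.

(** The pair of picked points has the law of two points sharing their
    coordinates in B and independent outside; integrating first over the
    unshared coordinates gives the square of the partial mean. *)
Lemma part_energyE n n' : part_energy (agree n n') =
  \int[iid]_x (psi (pick_coords n x) * psi (pick_coords n' x))%:E.
Proof.
set B := agree n n'.
pose G (z : dprod S * dprod S) : R := (psi z.1 * psi z.2)%R.
have mG : measurable_fun setT (EFin \o G).
  by apply/measurable_EFinP; apply: measurable_funM;
    [exact: (measurableT_comp mpsi measurable_fst)|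
     exact: (measurableT_comp mpsi measurable_snd)].
pose X : {mfun nested >-> (dprod S * dprod S)%type} :=
  mfun_Sub (mem_set (measurable_pick_pair n n')).
pose D : probability (dprod S * dprod S)%type R := distribution iid X.
pose P2 : probability (sub_dprod S (~: B)%SET * sub_dprod S (~: B)%SET)%type R :=
  (sub_prob Q (~: B)%SET \x sub_prob Q (~: B)%SET).
have tD : transports iid D (pick_pair n n').
  by split=> //; exact: measurable_pick_pair.
have tJ : transports (sub_prob Q B \x P2) D (@join_pair _ _ _ B).
  split=> [|U mU]; first exact: measurable_join_pair.
  exact: (esym (pick_pair_law Q n n' mU)).
have iD : D.-integrable setT (EFin \o G).
  apply/integrableP; split=> //.
  have mG' : measurable_fun setT (abse \o (EFin \o G)) by exact: measurableT_comp.
  rewrite -(ge0_integral_transports tD mG' (fun z => abse_ge0 _))//.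
  by have /integrableP[] := integrable_pick_mul n n'.
transitivity (\int[D]_z (G z)%:E); last first.
  by rewrite -(integral_transports tD iD).
rewrite -(integral_transports tJ iD).
rewrite -(integral12_prod_meas1 (integrable_transports tJ iD))/=.
apply: eq_integral => y _.
have ipsi := psi_def (~: B)%SET (glue_coords point y).
exact: (esym (integral_product ipsi ipsi)).
Qed.

End picks.

(** Two copies are enough to realise any set B as an agreement set, so
    every part energy is the correlation of psi at two recombined points. *)
Lemma agree_bool (B : {set 'I_K}) :
  agree (fun=> true) (fun k => k \in B) = B.
Proof. by apply/setP => k; rewrite finset.inE; case: (k \in B). Qed.

Lemma part_energy_fin_num B : part_energy B \is a fin_num.
Proof.
rewrite -(agree_bool B) part_energyE; apply: integrable_fin_num => //.
exact: integrable_pick_mul.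
Qed.

(** Twice the product of psi at the two points is at most the sum of
    the two squares, each of which integrates to the second moment of psi. *)
Lemma part_energy_le B : part_energy B <= \int[prod_prob Q]_x (psi x ^+ 2)%:E.
Proof.
rewrite -(agree_bool B) part_energyE.
move: (fun=> true) (fun k => k \in B) => n n'.
pose q n (x : dprod (fun _ : bool => dprod S)) := (psi (pick_coords n x) ^+ 2)%R.
have iq m : (prod_prob (fun _ : bool => prod_prob Q)).-integrable setT
    (fun x => (q m x)%:E) := integrable_transports (transports_pick m) psi2.
have Eq m := integral_transports (transports_pick m) psi2.
have iD := integrableD measurableT (iq n) (iq n').
apply: (@le_trans _ _ (\int[prod_prob (fun _ : bool => prod_prob Q)]_x
    (2^-1%:E * ((q n x)%:E + (q n' x)%:E)))).
  apply: le_integral => //; [exact: integrable_pick_mul|exact: integrableZl|].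
  move=> x _; rewrite -EFinD -EFinM lee_fin /q.
  by have := sqr_ge0 (psi (pick_coords n x) - psi (pick_coords n' x))%R; nra.
rewrite (integralZl measurableT iD) (integralD measurableT (iq n) (iq n')).
rewrite !Eq; have fin : \int[prod_prob Q]_x (psi x ^+ 2)%:E \is a fin_num.
  exact: integrable_fin_num.
by rewrite -(fineK fin) -EFinD -EFinM lee_fin; lra.
Qed.

(** This number is the square of the full mean of psi. *)
Lemma part_energy_set0 : \int[prod_prob Q]_x (psi x)%:E = 0 ->
  part_energy finset.set0 = 0.
Proof.
move=> psi0; rewrite /part_energy integral0_eq// => y _.
rewrite /part_mean finset.setC0.
have tg x : transports (sub_prob Q finset.setT) (prod_prob Q) (glue_coords x).
  split=> [|U mU]; last exact: glue_setT_law.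
  exact: (measurableT_comp (@measurable_glue _ _ S finset.setT) (measurable_pair1 x)).
have ipsi := integrable_sqr mpsi psi2.
by rewrite (integral_transports (tg _) ipsi) psi0 expe2 mule0.
Qed.

Section crossed_average.
Variable N : nat.
Local Notation nested := (dprod (fun _ : 'I_N.+1 => dprod S)).
Local Notation iid := (prod_prob (fun _ : 'I_N.+1 => prod_prob Q)).
Local Notation idx := {ffun 'I_K -> 'I_N.+1}.

(** The alternating sum of the asymptotic variance of the crossed
    estimator, for fixed theta; the term of the empty set A is included, as the
    combinatorial identity requires. *)
Definition anova_sum : R :=
  (\sum_(A : {set 'I_K}) (N.+1%:R ^+ #|A|)^-1 *
    \sum_(B : {set 'I_K} | B \subset A)
      (-1) ^+ (#|A| - #|B|) * fine (part_energy B))%R.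

Lemma measurable_cross_avg : measurable_fun setT (cross_avg (N := N) psi).
Proof.
apply: measurable_funM => //; apply: measurable_sum => n.
exact: measurable_psi_pick.
Qed.

Lemma cross_avg_sqrE x : ((cross_avg (N := N) psi x) ^+ 2)%:E =
  (((N.+1 ^ K)%:R^-1 ^+ 2)%:E * \sum_(n : idx) \sum_(n' : idx)
    (psi (pick_coords n x) * psi (pick_coords n' x))%:E).
Proof.
rewrite /cross_avg exprMn EFinM; congr (_ * _).
rewrite expr2 mulr_suml -sumEFin; apply: eq_bigr => n _.
by rewrite mulr_sumr -sumEFin.
Qed.

Lemma integrable_cross_avg_sqr :
  iid.-integrable setT (fun x => ((cross_avg (N := N) psi x) ^+ 2)%:E).
Proof.
rewrite (funext cross_avg_sqrE).
apply: integrableZl => //; apply: integrable_sum => // n _.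
by apply: integrable_sum => // n' _; exact: integrable_pick_mul.
Qed.

(** Expanding the square gives one part energy for each pair of
    multi-indices, and pairs are then counted by agreement set. *)
Lemma integral_cross_avg_sqr :
  \int[iid]_x ((cross_avg (N := N) psi x) ^+ 2)%:E = anova_sum%:E.
Proof.
rewrite (funext cross_avg_sqrE).
have isum (n : idx) : iid.-integrable setT (fun x : nested => \sum_(n' : idx)
    (psi (pick_coords n x) * psi (pick_coords n' x))%:E).
  by apply: integrable_sum => // n' _; exact: integrable_pick_mul.
rewrite integralZl//; last by apply: integrable_sum => // n _.
rewrite integral_sum//.
rewrite (eq_bigr (fun n : idx => (\sum_(n' : idx)
    fine (part_energy [set k | n k == n' k]%SET))%:E)); last first.
  move=> n _; rewrite integral_sum//; last by move=> n'; exact: integrable_pick_mul.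
  rewrite -sumEFin; apply: eq_bigr => n' _.
  by rewrite -part_energyE fineK// part_energy_fin_num.
rewrite sumEFin -EFinM; congr EFin.
(* Normalising N^K N^(K - |A|) by N^(-2 K) leaves the weight N^(-|A|). *)
rewrite (sum_agree _ (fun B => fine (part_energy B))) mulr_sumr.
apply: eq_bigr => A _; rewrite mulrA; congr (_ * _)%R.
rewrite !card_ord exprVn; have AK : (#|A| <= K)%N by rewrite -[leqRHS]card_ord max_card.
rewrite natrM !natrX exprB// ?unitfE ?pnatr_eq0//.
have N0 : (N.+1%:R != 0 :> R)%R by rewrite pnatr_eq0.
rewrite expr2 invfM -!mulrA mulKf ?expf_neq0// mulKf ?expf_neq0//.
Qed.

Hypothesis psi0 : \int[prod_prob Q]_x (psi x)%:E = 0.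

Lemma integral_cross_avg : \int[iid]_x (cross_avg (N := N) psi x)%:E = 0.
Proof.
have ipsi := integrable_sqr mpsi psi2.
have ip (n : idx) := integrable_transports (transports_pick (L := 'I_N.+1) n) ipsi.
rewrite (_ : (fun x => _) = (fun x : nested =>
    (N.+1 ^ K)%:R^-1%:E * \sum_(n : idx) (psi (pick_coords n x))%:E)); last first.
  by apply/funext => x; rewrite sumEFin -EFinM.
rewrite integralZl//; last by apply: integrable_sum => // n _.
rewrite integral_sum// big1 ?mule0// => n _.
by rewrite (integral_transports (transports_pick n) ipsi).
Qed.

Lemma cross_avgDr c x : cross_avg (N := N) (fun y => psi y + c)%R x =
  (cross_avg (N := N) psi x + c)%R.
Proof.
rewrite /cross_avg big_split/= sumr_const mulrDr; congr (_ + _)%R.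
by rewrite card_ffun !card_ord -[X in (_ * X)%R]mulr_natl mulKf// pnatr_eq0.
Qed.

Lemma std_avgDr c x : std_avg (N := N) (fun y => psi y + c)%R x =
  (std_avg (N := N) psi x + c)%R.
Proof.
rewrite /std_avg big_split/= sumr_const mulrDr; congr (_ + _)%R.
by rewrite card_ord -[X in (_ * X)%R]mulr_natl mulKf// pnatr_eq0.
Qed.

Lemma measurable_std_avg g : measurable_fun setT g ->
  measurable_fun setT (std_avg (N := N) (g : dprod S -> R)).
Proof.
move=> mg; apply: measurable_funM => //; apply: measurable_sum => i.
exact: (measurableT_comp mg ((jointly_generating_dprod _).1 i)).
Qed.

(** The left side is the second moment of the crossed average of psi + c,
    an average of shifted standard averages. *)
Lemma anova_sum_le c : (c ^+ 2 + anova_sum)%:E <=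
  \int[iid]_x ((std_avg (N := N) psi x + c) ^+ 2)%:E.
Proof.
have mF : measurable_fun setT (std_avg (N := N) (fun y => psi y + c)%R).
  by apply: measurable_std_avg; exact: measurable_funD.
have c0 : (0 < #|idx|)%N by rewrite card_ffun !card_ord expn_gt0.
have := integral_sqr_average_le (fun s : idx => transports_shift_copies Q s) c0 mF.
rewrite -(funext (fun x => congr1 (fun r : R => (r ^+ 2)%:E)
  (cross_avg_shift (fun y => psi y + c)%R x))).
rewrite (funext (fun x => congr1 (fun r : R => (r ^+ 2)%:E) (std_avgDr c x))).
apply: le_trans.
rewrite (funext (fun x => congr1 (fun r : R => (r ^+ 2)%:E) (cross_avgDr c x))).
rewrite (integral_sqrD_cst _ measurable_cross_avg integrable_cross_avg_sqr
  integral_cross_avg).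
by rewrite integral_cross_avg_sqr -EFinD lee_fin addrC.
Qed.

End crossed_average.

End pair_integrals.

(** * Integration over the conditioning variable *)

Section integrate_theta.
Context (R : realType) (K : nat) dT (Theta : measurableType dT)
  (dS : 'I_K -> measure_display) (S : forall k, measurableType (dS k))
  (mu0 : probability Theta R) (Mk : forall k, R.-pker Theta ~> S k).

Lemma measurable_Mprod U : measurable U ->
  measurable_fun setT (fun t => Mprod Mk t U).
Proof.
apply: measurable_prod_prob => k V mV.
exact: (measurable_kernel (Mk k) V mV).
Qed.

Lemma measurable_iid (L : finType) U : measurable U ->
  measurable_fun setT (fun t => prod_prob (fun _ : L => Mprod Mk t) U).
Proof. by apply: measurable_prod_prob => l V; exact: measurable_Mprod. Qed.

Lemma measurable_Mprod_sub A U : measurable U ->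
  measurable_fun setT (fun t => Mprod_sub Mk A t U).
Proof.
apply: measurable_prod_prob => k V mV.
exact: (measurable_kernel (Mk (val k)) V mV).
Qed.

(** The partial integral at (t, x) is the integral, against a kernel
    depending on (t, x), of a jointly measurable function of (t, x, y). *)
Lemma measurable_Mint A (g : Theta * dprod S -> \bar R) :
  measurable_fun setT g -> measurable_fun setT (Mint Mk A g).
Proof.
move=> mg.
pose h (p : (Theta * dprod S) * sub_dprod S A) : Theta * dprod S :=
  (p.1.1, glue_coords p.1.2 p.2).
have mh : measurable_fun setT h.
  have m11 : measurable_fun setT (fun p : (Theta * dprod S) * sub_dprod S A => p.1.1).
    exact: (measurableT_comp measurable_fst measurable_fst).
  have m12 : measurable_fun setT
      (fun p : (Theta * dprod S) * sub_dprod S A => (p.1.2, p.2)).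
    apply/measurable_fun_pairP; split => /=; last exact: measurable_snd.
    exact: (measurableT_comp measurable_snd measurable_fst).
  apply/measurable_fun_pairP; split => //.
  exact: (measurableT_comp (@measurable_glue _ _ S A) m12).
have mk V : measurable V ->
    measurable_fun setT (fun z : Theta * dprod S => Mprod_sub Mk A z.1 V).
  move=> mV; apply: (@measurableT_comp _ _ _ _ _ _ (fun t => Mprod_sub Mk A t V)) => //.
  exact: measurable_Mprod_sub.
exact: (measurable_fiber_integral_signed mk (measurableT_comp mg mh)).
Qed.

Variable phi : Theta * dprod S -> R.
Hypotheses (mphi : measurable_fun setT phi)
  (phi_def : partial_integrals_defined Mk (EFin \o phi)).

Definition mean_given (t : Theta) : \bar R := \int[Mprod Mk t]_x (phi (t, x))%:E.

Definition centered_given (t : Theta) (x : dprod S) : R :=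
  (phi (t, x) - fine (mean_given t))%R.

Lemma measurable_phi_given t : measurable_fun setT (fun x => phi (t, x)).
Proof. exact: (measurableT_comp mphi (measurable_pair1 t)). Qed.

Lemma transports_glueT t x :
  transports (Mprod_sub Mk finset.setT t) (Mprod Mk t) (glue_coords x).
Proof.
split=> [|U mU].
  exact: (measurableT_comp (@measurable_glue _ _ S finset.setT) (measurable_pair1 x)).
exact: (glue_setT_law (fun k => kernel_prob (Mk k) t)).
Qed.

Section square_integrable_fiber.
Variable t : Theta.
Hypothesis phi2 : (Mprod Mk t).-integrable setT (fun x => (phi (t, x) ^+ 2)%:E).

Let phi1 := integrable_sqr (measurable_phi_given t) phi2.

Lemma mean_given_fin_num : mean_given t \is a fin_num.
Proof. exact: integrable_fin_num. Qed.

Lemma Mint_setT x : Mint Mk finset.setT (EFin \o phi) (t, x) = mean_given t.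
Proof. exact: (integral_transports (transports_glueT t x) phi1). Qed.

Lemma measurable_centered_given : measurable_fun setT (centered_given t).
Proof. by apply: measurable_funB => //; exact: measurable_phi_given. Qed.

Lemma centered_given_mean0 : \int[Mprod Mk t]_x (centered_given t x)%:E = 0.
Proof.
rewrite /centered_given; under eq_integral do rewrite EFinB.
have ic : (Mprod Mk t).-integrable setT
    (fun x : dprod S => (fine (mean_given t))%:E : \bar R).
  exact: finite_measure_integrable_cst.
rewrite (integralB measurableT phi1 ic).
have := expectation_cst (Mprod Mk t) (fine (mean_given t)); rewrite unlock => ->.
by rewrite fineK ?mean_given_fin_num// subee// mean_given_fin_num.
Qed.

Lemma centered_given_sqr_integrable :
  (Mprod Mk t).-integrable setT (fun x => (centered_given t x ^+ 2)%:E).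
Proof.
have ic : (Mprod Mk t).-integrable setT
    (fun x : dprod S => (fine (mean_given t) ^+ 2)%:E : \bar R).
  exact: finite_measure_integrable_cst.
have i2 := integrableZl measurableT 2 (integrableD measurableT phi2 ic).
apply: (le_integrable measurableT _ _ i2).
  by apply/measurable_EFinP; apply: measurable_funX; exact: measurable_centered_given.
move=> x _; rewrite /= lee_fin !ger0_norm ?sqr_ge0//; last first.
  by rewrite mulr_ge0// addr_ge0// sqr_ge0.
rewrite /centered_given; have := sqr_ge0 (phi (t, x) + fine (mean_given t))%R.
by nra.
Qed.

(** The second moment of phi(t, .) is that of its centered
    version plus the square of the mean. *)
Lemma centered_given_sqr_le :
  \int[Mprod Mk t]_x (centered_given t x ^+ 2)%:E <=
  \int[Mprod Mk t]_x (phi (t, x) ^+ 2)%:E.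
Proof.
have := integral_sqrD_cst (fine (mean_given t)) measurable_centered_given
  centered_given_sqr_integrable centered_given_mean0.
under eq_integral do rewrite subrK.
by move=> ->; rewrite leeDl// lee_fin sqr_ge0.
Qed.

Lemma centered_given_def A x : (Mprod_sub Mk A t).-integrable setT
  (fun y => (centered_given t (glue_coords x y))%:E).
Proof.
rewrite /centered_given; apply: (eq_integrable measurableT
  (fun y => (EFin \o phi) (t, glue_coords x y) - (fine (mean_given t))%:E)).
  by move=> y _.
apply: integrableB => //; first exact: phi_def.
exact: finite_measure_integrable_cst.
Qed.

(** The integrands of the terms of the asymptotic variance, before
    integration over theta. *)
Definition energy_given (B : {set 'I_K}) (s : Theta) : \bar R :=
  Mint Mk B (fun z => (Mint Mk (~: B)%SET (EFin \o phi) z -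
    Mint Mk finset.setT (EFin \o phi) z) ^+ 2) (s, point).

(** The full partial integral M phi is the constant mean_given t, so that
    subtracting it after a partial integration is the same as centering phi
    beforehand. *)
Lemma energy_givenE B : energy_given B t =
  part_energy (fun k => kernel_prob (Mk k) t) (centered_given t) B.
Proof.
apply: eq_integral => y _; rewrite Mint_setT; congr (_ ^+ 2).
rewrite /part_mean /centered_given.
have ic : (Mprod_sub Mk (~: B)%SET t).-integrable setT
    (fun y : sub_dprod S (~: B)%SET => (fine (mean_given t))%:E : \bar R).
  exact: finite_measure_integrable_cst.
transitivity (\int[Mprod_sub Mk (~: B)%SET t]_u ((EFin \o phi)
    (t, glue_coords (glue_coords point y) u) - (fine (mean_given t))%:E)).
  rewrite (integralB measurableT (phi_def _ _ _) ic).
  have := expectation_cst (Mprod_sub Mk (~: B)%SET t) (fine (mean_given t)).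
  by rewrite unlock => ->; rewrite fineK ?mean_given_fin_num.
by apply: eq_integral => u _.
Qed.

End square_integrable_fiber.

Section integrated.
Variables (N : nat) (m : R).
Local Notation iid t := (prod_prob (fun _ : 'I_N.+1 => Mprod Mk t)).

Definition sqr_given (t : Theta) : \bar R :=
  \int[Mprod Mk t]_x (phi (t, x) ^+ 2)%:E.

Definition std_energy_given (t : Theta) : \bar R :=
  \int[iid t]_x ((std_avg (fun y => phi (t, y)) x - m) ^+ 2)%:E.

Hypothesis phi_sq : \int[mu0]_t sqr_given t < +oo.

Lemma measurable_sqr_given : measurable_fun setT sqr_given.
Proof.
apply: (measurable_fiber_integral measurable_Mprod
  (f := fun z => (phi z ^+ 2)%:E)).
  by apply/measurable_EFinP; exact: measurable_funX.
by move=> z; rewrite lee_fin sqr_ge0.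
Qed.

Lemma sqr_given_ge0 t : 0 <= sqr_given t.
Proof. by apply: integral_ge0 => x _; rewrite lee_fin sqr_ge0. Qed.

Lemma sqr_given_integrable : mu0.-integrable setT sqr_given.
Proof.
apply/integrableP; split; first exact: measurable_sqr_given.
by under eq_integral do rewrite gee0_abs ?sqr_given_ge0//.
Qed.

Lemma phi2_given t : sqr_given t \is a fin_num ->
  (Mprod Mk t).-integrable setT (fun x => (phi (t, x) ^+ 2)%:E).
Proof.
move=> fin; apply/integrableP; split.
  by apply/measurable_EFinP; apply: measurable_funX; exact: measurable_phi_given.
under eq_integral do rewrite gee0_abs ?lee_fin ?sqr_ge0//.
by rewrite -ge0_fin_numE ?sqr_given_ge0.
Qed.

Lemma measurable_phi_entry (i : 'I_N.+1) : measurable_fun setT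
  (fun z : Theta * dprod (fun _ : 'I_N.+1 => dprod S) => phi (z.1, z.2 i)).
Proof.
apply: (measurableT_comp mphi); apply/measurable_fun_pairP; split => /=.
  exact: measurable_fst.
exact: (measurableT_comp ((jointly_generating_dprod
  (fun _ : 'I_N.+1 => dprod S)).1 i) measurable_snd).
Qed.

Lemma measurable_std_energy_given : measurable_fun setT std_energy_given.
Proof.
apply: (measurable_fiber_integral (measurable_iid (L := 'I_N.+1))
  (f := fun z => ((std_avg (fun y => phi (z.1, y)) z.2 - m) ^+ 2)%:E)).
  apply/measurable_EFinP; apply: measurable_funX; apply: measurable_funB => //.
  apply: measurable_funM => //; apply: measurable_sum => i.
  exact: measurable_phi_entry.
by move=> z; rewrite lee_fin sqr_ge0.
Qed.

Lemma std_energy_given_ge0 t : 0 <= std_energy_given t.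
Proof. by apply: integral_ge0 => x _; rewrite lee_fin sqr_ge0. Qed.

(** (a - m)^2 <= 2 a^2 + 2 m^2, and the square of an average is at
    most the average of the squares. *)
Lemma std_energy_given_le t :
  std_energy_given t <= 2%:E * sqr_given t + (2 * m ^+ 2)%:E.
Proof.
pose e (i : 'I_N.+1) (x : dprod (fun _ : 'I_N.+1 => dprod S)) : \bar R :=
  (phi (t, x i) ^+ 2)%:E.
have mentry i : measurable_fun setT
    (fun x : dprod (fun _ : 'I_N.+1 => dprod S) => phi (t, x i)).
  exact: (measurableT_comp (measurable_phi_given t)
    (transports_coordinate (fun _ : 'I_N.+1 => Mprod Mk t) i).1).
have me i : measurable_fun setT (e i).
  by apply/measurable_EFinP; exact: measurable_funX.
have e0 i x : setT x -> 0 <= e i x by rewrite lee_fin sqr_ge0.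
have Ee i : \int[iid t]_x e i x = sqr_given t.
  apply: (ge0_integral_transports (transports_coordinate (fun _ : 'I_N.+1 => Mprod Mk t) i)
    (f := fun x => (phi (t, x) ^+ 2)%:E)).
    by apply/measurable_EFinP; apply: measurable_funX; exact: measurable_phi_given.
  by move=> y; rewrite lee_fin sqr_ge0.
have ms := emeasurable_sum (index_enum 'I_N.+1) me.
have s0 x : 0 <= \sum_i e i x by apply: sume_ge0 => i _; exact: e0.
have mc : measurable_fun setT (fun x : dprod (fun _ : 'I_N.+1 => dprod S) =>
  (2 / N.+1%:R)%:E * \sum_i e i x) by exact: measurable_funeM.
have cc : 0 <= (2 / N.+1%:R)%:E :> \bar R by rewrite lee_fin divr_ge0.
apply: (@le_trans _ _ (\int[iid t]_x
    ((2 / N.+1%:R)%:E * \sum_i e i x + (2 * m ^+ 2)%:E))).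
  apply: ge0_le_integral => //.
  - by move=> x _; rewrite lee_fin sqr_ge0.
  - apply/measurable_EFinP; apply: measurable_funX; apply: measurable_funB => //.
    by apply: measurable_funM => //; exact: measurable_sum.
  - exact: emeasurable_funD.
  - move=> x _; rewrite /e sumEFin -EFinM -EFinD lee_fin.
    have h := @sqr_average_le R 'I_N.+1 (fun i => phi (t, x i)).
    rewrite card_ord in h; have {h} := h isT.
    rewrite /std_avg; set A := (_ * _)%R; set B := (\sum_i phi (t, x i) ^+ 2)%R => h.
    have -> : (2 / N.+1%:R * B = 2 * (N.+1%:R^-1 * B))%R by rewrite mulrA.
    move: (N.+1%:R^-1 * B)%R h => C; move: A => A h.
    by have := sqr_ge0 (A + m)%R; nra.
rewrite ge0_integralD//; last 2 first.
- by move=> x _; exact: mule_ge0.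
- by move=> x _; rewrite lee_fin mulr_ge0// sqr_ge0.
rewrite (ge0_integralZl _ measurableT ms)// (ge0_integral_sum _ measurableT me e0).
rewrite (eq_bigr _ (fun i _ => Ee i)) sumr_const card_ord -[X in _ * X]mule_natl muleA.
rewrite -EFinM divfK ?pnatr_eq0//.
by have := expectation_cst (iid t) (2 * m ^+ 2); rewrite unlock => ->.
Qed.

Lemma std_energy_given_integrable : mu0.-integrable setT std_energy_given.
Proof.
have i2 := integrableZl measurableT 2 sqr_given_integrable.
have ic : mu0.-integrable setT (fun t : Theta => (2 * m ^+ 2)%:E : \bar R).
  exact: finite_measure_integrable_cst.
apply: (le_integrable measurableT measurable_std_energy_given _
  (integrableD measurableT i2 ic)) => t _.
rewrite gee0_abs ?std_energy_given_ge0// gee0_abs; first exact: std_energy_given_le.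
by rewrite adde_ge0 ?mule_ge0 ?sqr_given_ge0// lee_fin mulr_ge0 ?sqr_ge0.
Qed.

Lemma energy_given_ge0 B t : 0 <= energy_given B t.
Proof. by apply: integral_ge0 => y _; exact: sqre_ge0. Qed.

Lemma measurable_energy_given B : measurable_fun setT (energy_given B).
Proof.
have mpt : measurable_fun setT (fun t : Theta => (t, point) : Theta * dprod S).
  exact: measurable_pair2.
apply: (measurableT_comp _ mpt); apply: measurable_Mint.
have mE A : measurable_fun setT (Mint Mk A (EFin \o phi)).
  by apply: measurable_Mint; exact/measurable_EFinP.
by apply: emeasurable_funM; apply: emeasurable_funB; exact: mE.
Qed.

Lemma energy_given_le B t : sqr_given t \is a fin_num ->
  energy_given B t <= sqr_given t.
Proof.
move=> fin; have phi2 := phi2_given fin.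
rewrite (energy_givenE phi2); apply: (le_trans _ (centered_given_sqr_le phi2)).
apply: part_energy_le.
- exact: measurable_centered_given.
- exact: centered_given_sqr_integrable.
- exact: centered_given_def.
Qed.

(** The bound by the conditional second moment of phi holds where
    the latter is finite, hence almost everywhere. *)
Lemma energy_given_integrable B : mu0.-integrable setT (energy_given B).
Proof.
apply/integrableP; split; first exact: measurable_energy_given.
under eq_integral do rewrite gee0_abs ?energy_given_ge0//.
apply: le_lt_trans phi_sq; apply: ae_ge0_le_integral => //.
- by move=> t _; exact: energy_given_ge0.
- exact: measurable_energy_given.
- by move=> t _; exact: sqr_given_ge0.
- exact: measurable_sqr_given.
- have := integrable_ae measurableT sqr_given_integrable.
  by apply: filterS => t /(_ Logic.I) fin _; exact: energy_given_le.
Qed.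

(** The first term of the asymptotic variance, before integration over
    theta. *)
Definition bias_given (t : Theta) : \bar R :=
  (Mint Mk finset.setT (EFin \o phi) (t, point) - m%:E) ^+ 2.

Definition anova_given (t : Theta) : \bar R :=
  bias_given t + \sum_(A : {set 'I_K} | A != finset.set0)
    ((N.+1%:R ^+ #|A|)^-1)%:E * \sum_(B : {set 'I_K} | B \subset A)
      ((-1) ^+ (#|A| - #|B|))%:E * energy_given B t.

Lemma std_energy_centered t : \int[iid t]_x
  ((std_avg (centered_given t) x + (fine (mean_given t) - m)) ^+ 2)%:E =
  std_energy_given t.
Proof.
apply: eq_integral => x _; congr (_ ^+ 2)%:E.
rewrite addrA -(std_avgDr (centered_given t)); congr (_ - _)%R.
by rewrite /std_avg; congr (_ * _)%R; apply: eq_bigr => i _; rewrite subrK.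
Qed.

(** This is the inequality for a fixed law of the coordinates, applied
    to the centered function with the conditional bias as constant.  The empty
    set contributes nothing to the alternating sum, as the centered function
    has mean zero. *)
Lemma anova_given_le t : sqr_given t \is a fin_num ->
  anova_given t <= std_energy_given t.
Proof.
move=> fin; have phi2 := phi2_given fin.
have mc := measurable_centered_given t.
have c2 := centered_given_sqr_integrable phi2.
have cd := centered_given_def t.
have c0 := centered_given_mean0 phi2.
have := anova_sum_le mc c2 cd N c0 (fine (mean_given t) - m)%R.
rewrite std_energy_centered.
apply: le_trans; rewrite EFinD; apply: leeD.
  rewrite /bias_given Mint_setT// -(fineK (mean_given_fin_num phi2)).
  by rewrite -EFinB -EFin_expe.
rewrite /anova_sum [X in _ <= X%:E](bigD1 finset.set0)//=.
rewrite [X in _ <= (_ * X + _)%:E](bigD1 finset.set0)//=.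
rewrite [X in _ <= (_ * (_ + X) + _)%:E]big1 => [|B /andP[]]; last first.
  by rewrite finset.subset0 => ->.
rewrite (part_energy_set0 mc c2 c0) mulr0 addr0 mulr0 add0r -sumEFin.
apply: lee_sum => A _; rewrite EFinM lee_wpmul2l ?lee_fin ?invr_ge0//.
rewrite -sumEFin; apply: lee_sum => B _.
rewrite (energy_givenE phi2) EFinM fineK//.
exact: part_energy_fin_num.
Qed.

Lemma measurable_bias_given : measurable_fun setT bias_given.
Proof.
have mpt : measurable_fun setT (fun t : Theta => (t, point) : Theta * dprod S).
  exact: measurable_pair2.
have mE : measurable_fun setT (Mint Mk finset.setT (EFin \o phi)).
  by apply: measurable_Mint; exact/measurable_EFinP.
have mb := emeasurable_funB (measurableT_comp mE mpt) (measurable_cst m%:E).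
exact: (emeasurable_funM mb mb).
Qed.

(** What the conditional bias leaves over in the same inequality is a
    second moment, hence nonnegative. *)
Lemma bias_given_le t : sqr_given t \is a fin_num ->
  bias_given t <= std_energy_given t.
Proof.
move=> fin; have phi2 := phi2_given fin.
have mc := measurable_centered_given t.
have c2 := centered_given_sqr_integrable phi2.
have cd := centered_given_def t.
have c0 := centered_given_mean0 phi2.
have := anova_sum_le mc c2 cd N c0 (fine (mean_given t) - m)%R.
rewrite std_energy_centered; apply: le_trans.
rewrite /bias_given Mint_setT// -(fineK (mean_given_fin_num phi2)).
rewrite -EFinB -EFin_expe EFinD leeDl//.
rewrite -(integral_cross_avg_sqr mc c2 cd N).
by apply: integral_ge0 => x _; rewrite lee_fin sqr_ge0.
Qed.

Lemma bias_given_integrable : mu0.-integrable setT bias_given.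
Proof.
apply/integrableP; split; first exact: measurable_bias_given.
under eq_integral do rewrite gee0_abs ?sqre_ge0//.
apply: (@le_lt_trans _ _ (\int[mu0]_t std_energy_given t)).
  apply: ae_ge0_le_integral => //.
  - by move=> t _; exact: sqre_ge0.
  - exact: measurable_bias_given.
  - by move=> t _; exact: std_energy_given_ge0.
  - exact: measurable_std_energy_given.
  - have := integrable_ae measurableT sqr_given_integrable.
    by apply: filterS => t /(_ Logic.I) fin _; exact: bias_given_le.
have /integrableP[_] := std_energy_given_integrable.
by under eq_integral do rewrite gee0_abs ?std_energy_given_ge0//.
Qed.

Lemma integral_anova_given_le :
  \int[mu0]_t bias_given t + \sum_(A : {set 'I_K} | A != finset.set0)
    ((N.+1%:R ^+ #|A|)^-1)%:E * \sum_(B : {set 'I_K} | B \subset A)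
      ((-1) ^+ (#|A| - #|B|))%:E * \int[mu0]_t energy_given B t
  <= \int[mu0]_t std_energy_given t.
Proof.
have iB (A B : {set 'I_K}) := integrableZl measurableT ((-1) ^+ (#|A| - #|B|))%R
  (energy_given_integrable B).
have iA (A : {set 'I_K}) : mu0.-integrable setT (fun t => \sum_(B : {set 'I_K} | B \subset A)
      ((-1) ^+ (#|A| - #|B|))%:E * energy_given B t).
  by apply: integrable_sum => // B _; exact: (iB A B).
have iA' (A : {set 'I_K}) := integrableZl measurableT (N.+1%:R ^+ #|A|)^-1 (iA A).
have iS : mu0.-integrable setT (fun t => \sum_(A : {set 'I_K} | A != finset.set0)
    ((N.+1%:R ^+ #|A|)^-1)%:E * \sum_(B : {set 'I_K} | B \subset A)
      ((-1) ^+ (#|A| - #|B|))%:E * energy_given B t).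
  by apply: integrable_sum => // A _; exact: (iA' A).
have ian : mu0.-integrable setT anova_given.
  exact: (integrableD measurableT bias_given_integrable iS).
rewrite [leLHS](_ : _ = \int[mu0]_t anova_given t); last first.
  rewrite [RHS](integralD measurableT bias_given_integrable iS); congr (_ + _).
  rewrite (integral_sum measurableT iA'); apply: eq_bigr => A _.
  rewrite (integralZl measurableT (iA A)); congr (_ * _).
  rewrite (integral_sum measurableT (iB A)); apply: eq_bigr => B _.
  by rewrite (integralZl measurableT (energy_given_integrable B)).
(* Where phi(t, .) is not square integrable the alternating sum may involve
   infinite terms; these t form a null set, which is cut out of both integrals. *)
have [Nt [mNt Nt0 sub]] := integrable_ae measurableT sqr_given_integrable.
rewrite (negligible_integral mNt measurableT ian Nt0).
rewrite (negligible_integral mNt measurableT std_energy_given_integrable Nt0).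
have mD : measurable (setT `\` Nt) by exact: measurableD.
apply: le_integral => //.
- exact: integrableS ian.
- exact: integrableS std_energy_given_integrable.
move=> t /set_mem[_ tN]; apply: anova_given_le; apply: contrapT => nfin.
by apply: tN; apply: sub => /= /(_ Logic.I).
Qed.

End integrated.

End integrate_theta.

(** * Characteristic functions of independent sums *)

Section characteristic.
Context (R : realType).

(** The squared modulus of the characteristic function of f at 1, from its
    real and imaginary parts.  Passing to the modulus makes independent sums
    multiplicative without complex-valued integrals. *)
Definition sqnorm_charfun d (T : measurableType d) (P : probability T R)
    (f : T -> R) : R :=
  ((\int[P]_x cos (f x)) ^+ 2 + (\int[P]_x sin (f x)) ^+ 2)%R.

Lemma sqnorm_charfun_ge0 d (T : measurableType d) (P : probability T R)
    (f : T -> R) :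
  (0 <= sqnorm_charfun P f)%R.
Proof. by rewrite addr_ge0 ?sqr_ge0. Qed.

Lemma Rintegral_prob_cst d (T : measurableType d) (P : probability T R) (r : R) :
  (\int[P]_x (cst r x))%R = r.
Proof. by rewrite /Rintegral; have := expectation_cst P r; rewrite unlock => ->. Qed.

Lemma integrable_cos d (T : measurableType d) (P : probability T R) (f : T -> R) :
  measurable_fun setT f -> P.-integrable setT (fun x => (cos (f x))%:E).
Proof.
move=> mf; have i1 : P.-integrable setT (fun x : T => 1%:E : \bar R).
  exact: finite_measure_integrable_cst.
apply: (le_integrable measurableT _ _ i1).
  apply/measurable_EFinP; apply: (measurableT_comp _ mf).
  by apply: continuous_measurable_fun; exact: continuous_cos.
by move=> x _; rewrite /= lee_fin normr1 cos_max.
Qed.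

Lemma integrable_sin d (T : measurableType d) (P : probability T R) (f : T -> R) :
  measurable_fun setT f -> P.-integrable setT (fun x => (sin (f x))%:E).
Proof.
move=> mf; have i1 : P.-integrable setT (fun x : T => 1%:E : \bar R).
  exact: finite_measure_integrable_cst.
apply: (le_integrable measurableT _ _ i1).
  apply/measurable_EFinP; apply: (measurableT_comp _ mf).
  by apply: continuous_measurable_fun; exact: continuous_sin.
by move=> x _; rewrite /= lee_fin normr1 sin_max.
Qed.

Lemma sqnorm_charfun_transports d d' (T : measurableType d) (T' : measurableType d')
    (P : probability T R) (P' : probability T' R) (h : T -> T') (f : T' -> R) :
  transports P P' h -> measurable_fun setT f ->
  sqnorm_charfun P (f \o h) = sqnorm_charfun P' f.
Proof.
move=> hP mf; congr (_ ^+ 2 + _ ^+ 2)%R; congr fine.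
  exact: (integral_transports hP (integrable_cos P' mf)).
exact: (integral_transports hP (integrable_sin P' mf)).
Qed.

(** By the addition formulas the real and imaginary parts of the
    sum are those of the product of two complex numbers, and the modulus is
    multiplicative. *)
Lemma sqnorm_charfun_product d d' (T : measurableType d) (T' : measurableType d')
    (P : probability T R) (P' : probability T' R) (f : T -> R) (g : T' -> R) :
  measurable_fun setT f -> measurable_fun setT g ->
  sqnorm_charfun (P \x P') (fun p => f p.1 + g p.2)%R =
  (sqnorm_charfun P f * sqnorm_charfun P' g)%R.
Proof.
move=> mf mg; pose PP : probability (T * T')%type R := (P \x P')%E.
rewrite -[LHS]/(sqnorm_charfun PP (fun p => f p.1 + g p.2)%R) /sqnorm_charfun.
have icf := integrable_cos P mf; have isf := integrable_sin P mf.
have icg := integrable_cos P' mg; have isg := integrable_sin P' mg.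
have -> : (\int[PP]_p cos (f p.1 + g p.2) =
    (\int[P]_x cos (f x)) * (\int[P']_y cos (g y)) -
    (\int[P]_x sin (f x)) * (\int[P']_y sin (g y)))%R.
  rewrite (eq_Rintegral PP (g := fun p => cos (f p.1) * cos (g p.2) -
    sin (f p.1) * sin (g p.2))%R); last by move=> p _; rewrite cosD.
  rewrite RintegralB//; [|exact: (integrable_product icf icg)|exact: (integrable_product isf isg)].
  rewrite /Rintegral (integral_product icf icg) (integral_product isf isg).
  by rewrite !fineM// integrable_fin_num.
have -> : (\int[PP]_p sin (f p.1 + g p.2) =
    (\int[P]_x sin (f x)) * (\int[P']_y cos (g y)) +
    (\int[P]_x cos (f x)) * (\int[P']_y sin (g y)))%R.
  rewrite (eq_Rintegral PP (g := fun p => sin (f p.1) * cos (g p.2) +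
    cos (f p.1) * sin (g p.2))%R); last by move=> p _; rewrite sinD.
  rewrite RintegralD//; [|exact: (integrable_product isf icg)|exact: (integrable_product icf isg)].
  rewrite /Rintegral (integral_product isf icg) (integral_product icf isg).
  by rewrite !fineM// integrable_fin_num.
ring.
Qed.

(** The induction follows the recursive definition of the
    product law, whose last coordinate is drawn independently of the others. *)
Lemma sqnorm_charfun_prod_prob_seq d (T : measurableType d) (I : finType)
    (Q : I -> probability T R) (f : I -> T -> R) s :
  (forall i, measurable_fun setT (f i)) -> uniq s ->
  sqnorm_charfun (prod_prob_seq Q s) (fun x => \sum_(i <- s) f i (x i))%R =
  (\prod_(i <- s) sqnorm_charfun (Q i) (f i))%R.
Proof.
move=> mf; elim: s => [_|i s IH /= /andP[si us]].
  rewrite big_nil /sqnorm_charfun.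
  transitivity ((1 : R) ^+ 2 + 0 ^+ 2)%R; last by rewrite expr1n expr0n addr0.
  congr (_ ^+ 2 + _ ^+ 2)%R.
    rewrite (eq_Rintegral _ (g := cst 1%R)); last by move=> x _; rewrite big_nil cos0.
    exact: Rintegral_prob_cst.
  rewrite (eq_Rintegral _ (g := cst 0%R)); last by move=> x _; rewrite big_nil sin0.
  exact: Rintegral_prob_cst.
rewrite big_cons -IH// mulrC.
have mF (r : seq I) : measurable_fun setT
    (fun x : dprod (fun _ : I => T) => \sum_(j <- r) f j (x j))%R.
  apply: measurable_sum => j.
  exact: (measurableT_comp (mf j) ((jointly_generating_dprod (fun _ : I => T)).1 j)).
rewrite -sqnorm_charfun_product//.
have tr : transports (prod_prob_seq Q s \x Q i) (prod_prob_seq Q (i :: s))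
    (@dprod_set I _ (fun _ : I => T) i).
  by split=> //; exact: measurable_dprod_set.
rewrite -(sqnorm_charfun_transports tr (mF (i :: s))).
congr (_ ^+ 2 + _ ^+ 2)%R; apply: eq_Rintegral => p _ /=; congr (_ _);
  rewrite big_cons addrC /dprod_set eqtype.dfwith_in; congr (_ + _)%R;
  apply: eq_big_seq => j js; rewrite eqtype.dfwith_out//;
  by apply: contraNneq si => ->.
Qed.

End characteristic.

Section joint_law.
Context (R : realType) d dO (T : measurableType d) (Omega : measurableType dO)
  (P : probability Omega R) (W : nat -> {RV P >-> T}).
Hypothesis Windep : mutually_independent W.

Definition first_draws (M : nat) (w : Omega) : dprod (fun _ : 'I_M => T) :=
  fun i => W i w.

(** Mutual independence is the product formula on the boxes of
    the product space. *)
Lemma transports_first_draws M : transports P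
  (prod_prob (fun i : 'I_M => distribution P (W i))) (@first_draws M).
Proof.
have mf : measurable_fun setT (@first_draws M).
  by apply/measurable_fun_dprodP => i; exact: measurable_funPT.
split=> // U mU.
pose X : {mfun Omega >-> dprod (fun _ : 'I_M => T)} := mfun_Sub (mem_set mf).
refine (eq_prob_box (jointly_generating_dprod (fun _ : 'I_M => T))
  (m1 := distribution P X) (m2 := prod_prob _) _ mU) => C mC.
rewrite (prod_probE _ mC).
(* Mutual independence takes events indexed by all of nat. *)
pose E m : set T := if insub m is Some i then C i else setT.
have mE m : measurable (E m) by rewrite /E; case: insubP.
have EC (i : 'I_M) : E i = C i by rewrite /E valK.
have := Windep mE (iota_uniq 0 M).
rewrite (_ : \bigcap_(m in _) _ = X @^-1` box (fun i (x : dprod _) => x i) C).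
  move=> h; apply: (etrans h); rewrite -[M in iota 0 M]subn0 big_mkord.
  by apply: eq_bigr => i _; rewrite EC.
apply/seteqP; split=> [w h i|w h m /=].
  by rewrite -EC; apply: (h i); rewrite /= mem_iota/= add0n.
rewrite mem_iota add0n/= => mM.
by have := h (Ordinal mM); rewrite -EC.
Qed.

Lemma sqnorm_charfun_sum_draws M (f : T -> R) : measurable_fun setT f ->
  sqnorm_charfun P (fun w => \sum_(m < M) f (W m w))%R =
  (\prod_(m < M) sqnorm_charfun (distribution P (W m)) f)%R.
Proof.
move=> mf.
have mF : measurable_fun setT
    (fun x : dprod (fun _ : 'I_M => T) => \sum_(j < M) f (x j))%R.
  apply: measurable_sum => j.
  exact: (measurableT_comp mf ((jointly_generating_dprod (fun _ : 'I_M => T)).1 j)).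
rewrite -[LHS]/(sqnorm_charfun P ((fun x : dprod (fun _ : 'I_M => T) =>
  \sum_(j < M) f (x j))%R \o @first_draws M)).
rewrite (sqnorm_charfun_transports (transports_first_draws M) mF).
rewrite -big_enum -sqnorm_charfun_prod_prob_seq ?enum_uniq//.
congr (_ ^+ 2 + _ ^+ 2)%R; apply: eq_Rintegral => x _; congr (_ _);
  by rewrite big_enum.
Qed.

End joint_law.

(** * Elementary bounds on trigonometric and Gaussian integrals *)

Section trigonometry.
Context (R : realType).
Implicit Types x a : R.
Local Open Scope ring_scope.

Lemma sin_le_norm x : `|sin x| <= `|x|.
Proof.
wlog x0 : x / 0 <= x.
  move=> h; have [/h//|x0] := leP 0 x.
  by have := h (- x); rewrite sinN !normrN; apply; lra.
move: x0; rewrite le_eqVlt => /predU1P[<-|x0]; first by rewrite sin0.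
have [|c _] := @MVT R sin cos 0 x x0.
  by apply: continuous_subspaceT; exact: continuous_sin.
rewrite sin0 !subr0 => ->; rewrite normrM.
by rewrite ler_piMl// cos_max.
Qed.

Lemma one_sub_cosE x : 1 - cos x = 2 * sin (x / 2) ^+ 2.
Proof.
rewrite [in LHS](_ : x = (x / 2) *+ 2); last by rewrite -mulr_natr divfK.
by rewrite cos_mulr2n sin2cos2 -mulr_natr; ring.
Qed.

Lemma one_sub_cos_le x : 1 - cos x <= x ^+ 2 / 2.
Proof.
rewrite one_sub_cosE; have := sin_le_norm (x / 2).
rewrite -ler_sqr ?nnegrE// !real_normK ?num_real// => h.
have -> : x ^+ 2 / 2 = 2 * (x / 2) ^+ 2 by field.
by rewrite ler_pM2l.
Qed.

(** The derivative cos - 1 of sin - id is at most x^2 / 2 in absolute value.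
    The constant 1/2 is not optimal, but only the order of the error matters. *)
Lemma sin_sub_le x : `|sin x - x| <= `|x| ^+ 3 / 2.
Proof.
wlog x0 : x / 0 <= x.
  move=> h; have [/h//|x0] := leP 0 x.
  by have := h (- x); rewrite sinN -opprD !normrN; apply; lra.
move: x0; rewrite le_eqVlt => /predU1P[<-|x0].
  by rewrite sin0 subrr normr0 expr0n/= mul0r.
have [|c cx] := @MVT R sin cos 0 x x0.
  by apply: continuous_subspaceT; exact: continuous_sin.
rewrite sin0 !subr0 => ->.
rewrite -[X in _ - X]mul1r -mulrBl normrM distrC [`|1 - _|]ger0_norm ?subr_ge0 ?cos_le1//.
rewrite exprSr [leRHS]mulrAC ler_wpM2r//.
apply: (le_trans (one_sub_cos_le c)); rewrite ler_wpM2r//.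
move: cx; rewrite in_itv/= => /andP[c0 cx].
by rewrite ler_sqr ?nnegrE ?(ltW c0)// gtr0_norm// ltW.
Qed.

Lemma cvg_div_nat a : (fun M : nat => a / M%:R) @ \oo --> (0 : R).
Proof.
rewrite -[X in _ --> X](mulr0 a); apply: cvgM; first exact: cvg_cst.
apply/gtr0_cvgV0; last exact: cvgr_idn.
by near=> M; rewrite ltr0n; near: M; exists 1%N.
Unshelve. all: by end_near.
Qed.

Lemma cvg_sqrt_sin a :
  (fun M : nat => Num.sqrt M%:R * sin (a / Num.sqrt M%:R)) @ \oo --> a.
Proof.
apply/cvgrPdist_le => e e0.
have /cvgr0Pnorm_le/(_ _ e0) := cvg_div_nat (`|a| ^+ 3 / 2).
move=> h; near=> M.
have M0 : (0 < M)%N by near: M; exists 1%N.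
have sM0 : 0 < Num.sqrt M%:R :> R by rewrite sqrtr_gt0 ltr0n.
apply: (@le_trans _ _ `| `|a| ^+ 3 / 2 / M%:R|); last by near: M.
rewrite distrC -[X in _ * _ - X](mulVKf (lt0r_neq0 sM0)) -mulrBr.
rewrite normrM gtr0_norm// [(Num.sqrt _)^-1 * a]mulrC.
have := sin_sub_le (a / Num.sqrt M%:R).
rewrite -(ler_pM2l sM0); move=> /le_trans; apply.
rewrite [leRHS]ger0_norm ?divr_ge0// normrM normfV (gtr0_norm sM0).
have sE : (M%:R : R) = Num.sqrt M%:R ^+ 2 by rewrite sqr_sqrtr.
rewrite [in leRHS]sE; move: (Num.sqrt M%:R) sM0 => s s0.
rewrite le_eqVlt; apply/orP; left; apply/eqP.
by field; rewrite gt_eqF.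
Unshelve. all: by end_near.
Qed.

End trigonometry.

Section gaussian.
Context (R : realType).
Local Notation leb := (@lebesgue_measure R).

(** The Radon-Nikodym derivative of the normal law is almost
    everywhere its density, as both have the same integral over every
    measurable set. *)
Lemma integral_normal_prob (m s : R) (f : R -> \bar R) :
  (normal_prob m s).-integrable setT f ->
  \int[normal_prob m s]_x f x = \int[leb]_x (f x * (normal_pdf m s x)%:E).
Proof.
move=> fi; have mf := measurable_int _ fi.
have dom : normal_prob m s `<< leb := normal_prob_dominates m s.
rewrite -(Radon_Nikodym_change_of_variables dom measurableT fi)/=.
apply: ae_eq_integral => //.
- by apply: emeasurable_funM => //; apply: (measurable_int leb);
    exact: Radon_Nikodym_integrable.
- by apply: emeasurable_funM => //; apply/measurable_EFinP; exact: measurable_normal_pdf.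
- apply: ae_eqe_mul2l => /=.
  rewrite Radon_NikodymE//=.
  case: cid => /= h [h1 h2 h3].
  apply: integral_ae_eq => //=.
  + by apply/measurable_EFinP; exact: measurable_normal_pdf.
  + by move=> E _ mE; rewrite -h3.
Qed.

(** Multiplying a centered normal density by exp(e x^2) gives,
    for small e, a multiple of a wider one; e is chosen here so that the
    standard deviation is multiplied by r. *)
Lemma gaussian_pdf_scale (s r x : R) : (0 < s)%R -> (1 < r)%R ->
  (r * normal_pdf 0 (r * s) x =
   expR ((1 - r ^- 2) / (2 * s ^+ 2) * x ^+ 2) * normal_pdf 0 s x)%R.
Proof.
move=> s0 r1; have r0 : (0 < r)%R by lra.
rewrite !normal_pdfE ?gt_eqF ?mulr_gt0// /normal_peak /normal_fun !subr0.
have -> : (Num.sqrt ((r * s) ^+ 2 * pi *+ 2) = r * Num.sqrt (s ^+ 2 * pi *+ 2))%R.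
  rewrite exprMn -mulrA -mulrnAr sqrtrM ?sqr_ge0// sqrtr_sqr gtr0_norm//.
rewrite invfM -!mulrA mulVKf ?gt_eqF// [RHS]mulrCA -expRD.
congr (_ * expR _)%R.
by field; rewrite !gt_eqF.
Qed.

Lemma measurable_cos_scale (t : R) : measurable_fun setT (fun x : R => cos (t * x)).
Proof.
apply: continuous_measurable_fun => x.
apply: continuous_comp; last exact: continuous_cos.
exact: mulrl_continuous.
Qed.

(** With e the exponent of the rescaling above, 1 - cos(t x) is
    at most t^2 x^2 / 2, hence at most (t^2 / (2 e)) (exp(e x^2) - 1), and the
    integral of exp(e x^2) is r.  This bounds the integral of 1 - cos(t x)
    without computing a second moment. *)
Lemma normal_cos_ge_scale (s t r : R) : (0 < s)%R -> (1 < r)%R ->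
  (1 - t ^+ 2 * s ^+ 2 * (r ^+ 2 / (r + 1)))%:E <=
  \int[normal_prob 0 s]_x (cos (t * x))%:E.
Proof.
move=> s0 r1; have r0 : (0 < r)%R by lra.
have icos : (normal_prob 0 s : probability _ R).-integrable setT
    (fun x => (cos (t * x))%:E).
  by apply: integrable_cos; apply: measurable_funM.
have ifin := integrable_fin_num measurableT icos.
pose e := ((1 - r ^- 2) / (2 * s ^+ 2))%R.
have e0 : (0 < e)%R.
  rewrite divr_gt0// ?mulr_gt0// ?exprn_gt0// subr_gt0 invf_lt1 ?exprn_gt0//.
  by rewrite exprn_egt1.
pose k := (t ^+ 2 / (2 * e))%R.
have k0 : (0 <= k)%R by rewrite divr_ge0 ?sqr_ge0// mulr_ge0// ltW.
rewrite -(fineK ifin) lee_fin; set I := fine _.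
(* I stands for the integral of cos(t x), and k r for that of k exp(e x^2). *)
suff : ((1 + k)%:E <= I%:E + (k * r)%:E).
  rewrite -EFinD lee_fin => h.
  have -> : (t ^+ 2 * s ^+ 2 * (r ^+ 2 / (r + 1)) = k * (r - 1))%R.
    have r21 : (r ^+ 2 - 1 != 0)%R by rewrite gt_eqF// subr_gt0 exprn_egt1.
    have rD1 : (r + 1 != 0)%R by rewrite gt_eqF// addr_gt0.
    by rewrite /k /e; field; rewrite r21 rD1 !gt_eqF.
  lra.
rewrite /I (fineK ifin) integral_normal_prob//.
have ip u : leb.-integrable setT (fun x => (normal_pdf 0 u x)%:E).
  exact: integrable_normal_pdf.
have E (c u : R) : \int[leb]_x (c%:E * (normal_pdf 0 u x)%:E) = c%:E.
  by rewrite integralZl// integral_normal_pdf mule1.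
rewrite -(E (1 + k)%R s) -(E (k * r)%R (r * s)%R).
have icp : leb.-integrable setT (fun x => (cos (t * x))%:E * (normal_pdf 0 s x)%:E).
  apply: (le_integrable measurableT _ _ (ip s)).
    apply: emeasurable_funM; apply/measurable_EFinP.
      exact: measurable_cos_scale.
    exact: measurable_normal_pdf.
  move=> x _; rewrite -EFinM lee_fin normrM.
  by rewrite ler_piMl// cos_max.
have iZ c u := integrableZl measurableT c (ip u).
rewrite -(integralD measurableT icp (iZ (k * r)%R (r * s)%R)).
apply: (le_integral measurableT (iZ (1 + k)%R s)
  (integrableD measurableT icp (iZ (k * r)%R (r * s)%R))) => x _.
rewrite -!EFinM -EFinD lee_fin -mulrA gaussian_pdf_scale// -/e.
have p0 := normal_pdf_ge0 0 s x; move: (normal_pdf 0 s x) p0 => p p0.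
rewrite mulrA -mulrDl ler_wpM2r//.
have h1 := one_sub_cos_le (t * x); have h2 := expR_ge1Dx (e * x ^+ 2).
have h3 : (k * (e * x ^+ 2) <= k * (expR (e * x ^+ 2) - 1))%R.
  by rewrite ler_wpM2l//; lra.
have h4 : (k * (e * x ^+ 2) = (t * x) ^+ 2 / 2)%R.
  by rewrite /k; field; rewrite gt_eqF.
by rewrite h4 in h3; lra.
Qed.

(** For s2 > 0 let r tend to 1 in the previous bound, where
    r^2 / (r + 1) tends to 1/2. *)
Lemma gaussian_cos_ge (s2 t : R) : (0 <= s2)%R ->
  (1 - t ^+ 2 * s2 / 2)%:E <= \int[gaussian s2]_x (cos (t * x))%:E.
Proof.
rewrite le_eqVlt => /predU1P[<-|s20].
  rewrite /gaussian eqxx integral_dirac//; last first.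
    by apply/measurable_EFinP; exact: measurable_cos_scale.
  by rewrite diracT mul1e !mulr0 cos0 mul0r subr0.
rewrite /gaussian gt_eqF//; set s := Num.sqrt s2.
have s0 : (0 < s)%R by rewrite sqrtr_gt0.
have s2E : (s2 = s ^+ 2)%R by rewrite sqr_sqrtr// ltW.
have icos : (normal_prob 0 s : probability _ R).-integrable setT
    (fun x => (cos (t * x))%:E).
  by apply: integrable_cos; apply: measurable_funM.
have ifin := integrable_fin_num measurableT icos.
rewrite -(fineK ifin) lee_fin; set I := fine _.
apply/ler_addgt0Pr => e e0.
set q := (t ^+ 2 * s2)%R.
have q0 : (0 <= q)%R by rewrite mulr_ge0 ?sqr_ge0// ltW.
(* r^2 / (r + 1) <= 1/2 + (r - 1), so r - 1 has to be at most e / q. *)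
pose r := (1 + e / (q + 1))%R.
have r1 : (1 < r)%R by rewrite ltrDl divr_gt0//; lra.
have := normal_cos_ge_scale t s0 r1.
rewrite -(fineK ifin) lee_fin -/I -s2E -/q => h.
have h1 : (r ^+ 2 / (r + 1) <= 2^-1 + (r - 1))%R.
  by rewrite ler_pdivrMr; nra.
have h2 : (q * (r ^+ 2 / (r + 1)) <= q * (2^-1 + (r - 1)))%R by rewrite ler_wpM2l.
have h3 : (q * (r - 1) <= e)%R.
  rewrite /r addrC addKr mulrCA; apply: ler_piMr; first exact: ltW.
  by rewrite ler_pdivrMr; lra.
lra.
Qed.

End gaussian.

(** * A lower bound on the variance of a Gaussian limit *)

Section dominated.
Context (R : realType) d (T : measurableType d) (P : probability T R).

Lemma Rintegral_dominated_cvg (f_ : nat -> T -> R) (f g : T -> R) :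
  (forall n, measurable_fun setT (f_ n)) -> measurable_fun setT f ->
  (forall x, f_ ^~ x @ \oo --> f x) ->
  P.-integrable setT (EFin \o g) -> (forall n x, `|f_ n x| <= g x)%R ->
  (fun n => \int[P]_x f_ n x)%R @ \oo --> (\int[P]_x f x)%R.
Proof.
move=> mf_ mf f_f ig f_g.
have mEf_ n : measurable_fun setT (EFin \o f_ n) by exact/measurable_EFinP.
have mEf : measurable_fun setT (EFin \o f) by exact/measurable_EFinP.
have cE : {ae P, forall x, setT x -> (fun n => (EFin \o f_ n) x) @ \oo --> (EFin \o f) x}.
  by apply: aeW => x _; apply/fine_cvgP; split; [exact: nearW|exact: f_f].
have dE : {ae P, forall x n, setT x -> `|(EFin \o f_ n) x| <= (EFin \o g) x}.
  by apply: aeW => x n _; rewrite /= lee_fin f_g.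
have [intf _ cv] := dominated_convergence measurableT mEf_ mEf cE ig dE.
by apply: fine_cvg; rewrite fineK//; exact: integrable_fin_num.
Qed.

End dominated.

Section central_limit.
Context (R : realType) d (T : measurableType d) (P : probability T R).
Variable y : T -> R.
Hypotheses (my : measurable_fun setT y)
  (y2 : P.-integrable setT (fun x => (y x ^+ 2)%:E))
  (y0 : \int[P]_x (y x)%:E = 0).
Local Open Scope ring_scope.
Local Notation v := (\int[P]_x (y x ^+ 2)).
Variable t : R.

Let scaled (M : nat) (x : T) : R := t * y x / Num.sqrt M%:R.

Let mscaled M : measurable_fun setT (scaled M).
Proof. by apply: measurable_funM => //; apply: measurable_funM. Qed.

Let iy := integrable_sqr my y2.

Lemma sqrt_sin_le (M : nat) (a : R) :
  `|Num.sqrt M%:R * sin (a / Num.sqrt M%:R)| <= `|a|.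
Proof.
have [->|M0] := eqVneq M 0%N; first by rewrite sqrtr0 mul0r normr0.
have s0 : 0 < Num.sqrt M%:R :> R by rewrite sqrtr_gt0 ltr0n lt0n.
rewrite normrM gtr0_norm// -ler_pdivlMl//.
apply: (le_trans (sin_le_norm _)).
by rewrite normrM normfV (gtr0_norm s0) mulrC.
Qed.

(** The integrand converges to t y, which is centered, and is
    dominated by |t y|. *)
Lemma cvg_sqrt_mean_sin :
  (fun M : nat => Num.sqrt M%:R * \int[P]_x sin (scaled M x)) @ \oo --> (0 : R).
Proof.
have -> : (0 : R) = \int[P]_x (t * y x).
  by rewrite RintegralZl// /Rintegral y0 mulr0.
under eq_fun do rewrite -RintegralZl ?(integrable_sin P (mscaled _))//.
apply: (@Rintegral_dominated_cvg _ _ _ _ _ _ (fun x => `|t * y x|)).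
- move=> M; apply: measurable_funM => //; apply: (measurableT_comp _ (mscaled M)).
  by apply: continuous_measurable_fun; exact: continuous_sin.
- exact: measurable_funM.
- by move=> x; exact: cvg_sqrt_sin.
- have := integrable_norm (integrableZl measurableT t iy).
  by apply: eq_integrable => // x _ /=; rewrite normrM.
- by move=> M x; exact: sqrt_sin_le.
Qed.

Lemma nat_one_sub_cosE (M : nat) (a : R) :
  M%:R * (1 - cos (a / Num.sqrt M%:R)) =
  2 * (Num.sqrt M%:R * sin ((a / 2) / Num.sqrt M%:R)) ^+ 2.
Proof.
rewrite one_sub_cosE exprMn sqr_sqrtr// mulrCA; congr (_ * (_ * sin _ ^+ 2)).
by rewrite mulrAC.
Qed.

(** Half-angle formula: M (1 - cos(t y / sqrt M)) is
    2 (sqrt M sin(t y / (2 sqrt M)))^2, which converges to t^2 y^2 / 2 and is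
    dominated by it. *)
Lemma cvg_nat_one_sub_mean_cos :
  (fun M : nat => M%:R * (1 - \int[P]_x cos (scaled M x))) @ \oo -->
  t ^+ 2 * v / 2.
Proof.
have -> : t ^+ 2 * v / 2 = \int[P]_x (2 * (t * y x / 2) ^+ 2).
  rewrite mulrAC -RintegralZl//; by apply: eq_Rintegral => x _; field.
have i1 : P.-integrable setT (fun x : T => 1%:E) by exact: finite_measure_integrable_cst.
have -> : (fun M : nat => M%:R * (1 - \int[P]_x cos (scaled M x))) =
    (fun M : nat => \int[P]_x
      (2 * (Num.sqrt M%:R * sin ((t * y x / 2) / Num.sqrt M%:R)) ^+ 2)).
  apply/funext => M; rewrite -[X in X - _](Rintegral_prob_cst P) -RintegralB//; last first.
    exact: (integrable_cos P (mscaled M)).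
  rewrite -RintegralZl//; last first.
    exact: (integrableB measurableT i1 (integrable_cos P (mscaled M))).
  by apply: eq_Rintegral => x _; rewrite -nat_one_sub_cosE.
apply: (@Rintegral_dominated_cvg _ _ _ _ _ _ (fun x => 2 * (t * y x / 2) ^+ 2)).
- move=> M; apply: measurable_funM => //; apply: measurable_funX.
  apply: measurable_funM => //; apply: measurableT_comp.
    by apply: continuous_measurable_fun; exact: continuous_sin.
  by apply: measurable_funM => //; apply: measurable_funM => //; exact: measurable_funM.
- apply: measurable_funM => //; apply: measurable_funX.
  by apply: measurable_funM => //; exact: measurable_funM.
- move=> x; apply: cvgM; first exact: cvg_cst.
  under eq_fun do rewrite expr2; rewrite expr2.
  by apply: cvgM; exact: cvg_sqrt_sin.
- have := integrableZl measurableT (t ^+ 2 / 2) y2.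
  by apply: eq_integrable => // x _; rewrite /= -EFinM; congr EFin; field.
- move=> M x; have := sqrt_sin_le M (t * y x / 2).
  rewrite -ler_sqr ?nnegrE// !real_normK ?num_real// => h.
  rewrite ger0_norm; last by rewrite mulr_ge0 ?sqr_ge0.
  by rewrite ler_pM2l.
Qed.

(** With c and s the means of the cosine and the sine,
    M (c^2 + s^2 - 1) = (sqrt M s)^2 - 2 M (1 - c) + (M (1 - c))^2 / M, where
    sqrt M s tends to 0 and M (1 - c) to t^2 v / 2. *)
Lemma cvg_nat_sqnorm_charfun_sub1 :
  (fun M : nat => M%:R * (sqnorm_charfun P (scaled M) - 1)) @ \oo --> - (t ^+ 2 * v).
Proof.
pose S (M : nat) := Num.sqrt M%:R * \int[P]_x sin (scaled M x).
pose C (M : nat) := M%:R * (1 - \int[P]_x cos (scaled M x)).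
have -> : - (t ^+ 2 * v) = 0 * 0 + ((- 2) * (t ^+ 2 * v / 2) +
  (t ^+ 2 * v / 2) * (t ^+ 2 * v / 2) * 0) by field.
have cC : C @ \oo --> t ^+ 2 * v / 2 := cvg_nat_one_sub_mean_cos.
have cS : S @ \oo --> (0 : R) := cvg_sqrt_mean_sin.
have c1 : (fun M : nat => (M%:R : R)^-1) @ \oo --> (0 : R).
  by have := cvg_div_nat (1 : R); under eq_fun do rewrite div1r.
have -> : (fun M : nat => M%:R * (sqnorm_charfun P (scaled M) - 1)) =
    (fun M => S M * S M + ((- 2) * C M + C M * C M * (M%:R : R)^-1)).
  apply/funext => M; rewrite /S /C /sqnorm_charfun.
  move: (\int[P]_x cos _) (\int[P]_x sin _) => c s.
  have [->|M0] := eqVneq M 0%N; first by rewrite sqrtr0 !mul0r !mulr0 !addr0.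
  have sM : (M%:R : R) = Num.sqrt M%:R ^+ 2 by rewrite sqr_sqrtr.
  have s0 : Num.sqrt M%:R != 0 :> R by rewrite gt_eqF// sqrtr_gt0 ltr0n lt0n.
  move: (Num.sqrt M%:R) sM s0 => q -> q0.
  by field.
apply: cvgD; first exact: cvgM.
apply: cvgD; first by apply: cvgM => //; exact: cvg_cst.
by apply: cvgM => //; exact: cvgM.
Qed.

(** For a >= 0, a <= exp(a - 1) gives a^M <= exp(M (a - 1)): an
    upper bound is all that is needed, and no logarithm has to be taken. *)
Lemma sqnorm_charfun_power_limit (C : nat -> R) (l : R) : C @ \oo --> l ->
  (forall M, C M ^+ 2 <= sqnorm_charfun P (scaled M) ^+ M) ->
  l ^+ 2 <= expR (- (t ^+ 2 * v)).
Proof.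
move=> Cl Cle.
have c2 : (fun M => C M ^+ 2) @ \oo --> l ^+ 2.
  under eq_fun do rewrite expr2; rewrite expr2; exact: cvgM.
have ce : (fun M : nat => expR (M%:R * (sqnorm_charfun P (scaled M) - 1))) @ \oo -->
    expR (- (t ^+ 2 * v)).
  apply: (cvg_comp _ expR cvg_nat_sqnorm_charfun_sub1); exact: continuous_expR.
apply: (ler_cvg_to c2 ce); apply: nearW => M.
apply: (le_trans (Cle M)); rewrite mulrC expRM_natr.
apply: lerXn2r; rewrite ?nnegrE ?sqnorm_charfun_ge0 ?expR_ge0//.
by rewrite -[leLHS](subrKC 1) expR_ge1Dx.
Qed.

End central_limit.

(** The two bounds give (1 - t^2 s2 / 2)^2 <= exp(- t^2 v) for small
    t, an inequality between 1 - t^2 s2 and 1 - t^2 v up to order t^4. *)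
Lemma le_of_gaussian_bound (R : realType) (v s2 : R) : (0 <= v)%R -> (0 <= s2)%R ->
  (forall t : R, exists2 l : R, (1 - t ^+ 2 * s2 / 2 <= l)%R &
     (l ^+ 2 <= expR (- (t ^+ 2 * v)))%R) -> (v <= s2)%R.
Proof.
move=> v0 s0 H; rewrite leNgt; apply/negP => s2v.
(* (1 - u s2) (1 + u v) <= 1 gives v - s2 <= u s2 v; this u makes the right
   side at most (v - s2) / 2. *)
pose u := ((v - s2) / (2 * (s2 * v + 1)))%R.
have sv : (0 < s2 * v + 1)%R by rewrite ltr_wpDl// mulr_ge0.
have u0 : (0 < u)%R by rewrite divr_gt0 ?subr_gt0// mulr_gt0.
have uE : (u * (2 * (s2 * v + 1)) = v - s2)%R.
  by rewrite /u divfK// gt_eqF// mulr_gt0.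
have [l] := H (Num.sqrt u); rewrite (sqr_sqrtr (ltW u0)) => lb le.
have us : (u * s2 <= 1)%R by nra.
have le' : (1 - u * s2 <= expR (- (u * v)))%R by nra.
have e1 := expR_ge1Dx (u * v).
have e2 : (expR (- (u * v)) * expR (u * v) = 1)%R by rewrite -expRD addNr expR0.
have e3 := expR_gt0 (u * v); have e4 := expR_gt0 (- (u * v)).
have h : ((1 - u * s2) * (1 + u * v) <= 1)%R.
  rewrite -e2; apply: ler_pM => //; nra.
nra.
Qed.

(** * Variances under law-preserving maps *)

Section variances.
Context (R : realType).

Lemma varianceEsqr d (T : measurableType d) (P : probability T R) (F : T -> R) :
  'V_P[F] = \int[P]_x ((F x - fine 'E_P[F]) ^+ 2)%:E.
Proof.
rewrite /variance unlock expectation.unlock.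
by apply: eq_integral.
Qed.

Lemma expectation_transports d d' (T : measurableType d) (T' : measurableType d')
    (P : probability T R) (P' : probability T' R) (h : T -> T') (F : T' -> R) :
  transports P P' h -> P'.-integrable setT (EFin \o F) ->
  'E_P[F \o h] = 'E_P'[F].
Proof.
by move=> tr iF; rewrite expectation.unlock -(integral_transports tr iF).
Qed.

Lemma variance_transports d d' (T : measurableType d) (T' : measurableType d')
    (P : probability T R) (P' : probability T' R) (h : T -> T') (F : T' -> R) :
  transports P P' h -> P'.-integrable setT (EFin \o F) ->
  'V_P[F \o h] = 'V_P'[F].
Proof.
move=> tr iF; rewrite !varianceEsqr (expectation_transports tr iF).
have mF : measurable_fun setT F by apply/measurable_EFinP; exact: measurable_int iF.
rewrite -(ge0_integral_transports tr)//.
- by apply/measurable_EFinP; apply: measurable_funX; exact: measurable_funB.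
- by move=> y; rewrite lee_fin sqr_ge0.
Qed.

(** All the F o h i have the mean of F, so this is the convexity
    inequality for the centered function. *)
Lemma variance_average_le d (T : measurableType d) (P : probability T R)
    (I : finType) (h : I -> T -> T) (F : T -> R) :
  (forall i, transports P P (h i)) -> (0 < #|I|)%N ->
  P.-integrable setT (EFin \o F) ->
  'V_P[fun x => (#|I|%:R^-1 * \sum_i F (h i x))%R] <= 'V_P[F].
Proof.
move=> hP I0 iF.
have mF : measurable_fun setT F by apply/measurable_EFinP; exact: measurable_int iF.
have I0' : (#|I|%:R != 0 :> R)%R by rewrite pnatr_eq0 -lt0n.
have iFh i : P.-integrable setT (EFin \o (F \o h i)) := integrable_transports (hP i) iF.
rewrite !varianceEsqr.
have -> : 'E_P[fun x => (#|I|%:R^-1 * \sum_i F (h i x))%R] = 'E_P[F].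
  have fin : \int[P]_x (F x)%:E \is a fin_num by exact: integrable_fin_num.
  rewrite expectation.unlock.
  rewrite (eq_integral (fun x => #|I|%:R^-1%:E * \sum_i (F (h i x))%:E)); last first.
    by move=> x _; rewrite EFinM -sumEFin.
  rewrite integralZl//; last by apply: integrable_sum => // i _; exact: iFh.
  rewrite integral_sum//.
  rewrite (eq_bigr (fun=> \int[P]_x (F x)%:E)); last first.
    by move=> i _; exact: (integral_transports (hP i) iF).
  by rewrite sumr_const -[X in _ * X]mule_natl muleA -EFinM mulVf// mul1e.
set m := fine _.
have := integral_sqr_average_le hP I0 (measurable_funB mF (measurable_cst m)).
apply: le_trans; rewrite le_eqVlt; apply/orP; left; apply/eqP.
apply: eq_integral => x _; congr (_ ^+ 2)%:E.
by rewrite sumrB sumr_const -(mulr_natl m) mulrBr mulKf.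
Qed.

End variances.

Section fibers.
Context (R : realType) dT (T : measurableType dT) (mu0 : probability T R).

(** A map acting on the second component only acts fibrewise: it
    transports nu as soon as it transports the conditional laws. *)
Lemma transports_fiber dY dY' (Y : measurableType dY) (Y' : measurableType dY')
    (Q : T -> probability Y R) (Q' : T -> probability Y' R)
    (nu : probability (T * Y)%type R) (nu' : probability (T * Y')%type R)
    (h : Y -> Y') :
  (forall U, measurable U -> measurable_fun setT (fun t => Q t U)) ->
  (forall U, measurable U -> measurable_fun setT (fun t => Q' t U)) ->
  disintegrates mu0 Q nu -> disintegrates mu0 Q' nu' ->
  measurable_fun setT h -> (forall t, transports (Q t) (Q' t) h) ->
  transports nu nu' (fun z => (z.1, h z.2)).
Proof.
move=> mQ mQ' dnu dnu' mh hQ.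
have mH : measurable_fun setT (fun z : T * Y => (z.1, h z.2)).
  apply/measurable_fun_pairP; split => /=; first exact: measurable_fst.
  exact: (measurableT_comp mh measurable_snd).
split=> // U mU.
have mHU : measurable ((fun z : T * Y => (z.1, h z.2)) @^-1` U).
  by rewrite -[X in measurable X]setTI; exact: mH.
rewrite -[in LHS](setIT (_ @^-1` U)) -[in RHS](setIT U) -!integral_indic//.
rewrite (integral_disintegrates mQ dnu); last 2 first.
- by apply/measurable_EFinP; exact: measurable_indic.
- by move=> z; rewrite lee_fin.
rewrite (integral_disintegrates mQ' dnu'); last 2 first.
- by apply/measurable_EFinP; exact: measurable_indic.
- by move=> z; rewrite lee_fin.
apply: eq_integral => t _; rewrite -(ge0_integral_transports (hQ t))//.
apply/measurable_EFinP; apply: (measurableT_comp _ (measurable_pair1 t)).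
exact: measurable_indic.
Qed.

(** The identity transports the conditional laws. *)
Lemma disintegrates_unique dY (Y : measurableType dY) (Q : T -> probability Y R)
    (nu nu' : probability (T * Y)%type R) U :
  (forall U, measurable U -> measurable_fun setT (fun t => Q t U)) ->
  disintegrates mu0 Q nu -> disintegrates mu0 Q nu' ->
  measurable U -> nu U = nu' U.
Proof.
move=> mQ dnu dnu' mU.
have tid t : transports (Q t) (Q t) id by split.
have [_ h] := transports_fiber mQ mQ dnu dnu' (@measurable_id _ _ setT) tid.
rewrite -(h U mU); congr (nu _).
by apply/seteqP; split => -[].
Qed.

End fibers.

Lemma transports_prod_prob (R : realType) (I : finType) (d d' : I -> measure_display)
    (S : forall i, measurableType (d i)) (S' : forall i, measurableType (d' i))
    (Q : forall i, probability (S i) R) (Q' : forall i, probability (S' i) R)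
    (h : forall i, S i -> S' i) :
  (forall i, transports (Q i) (Q' i) (h i)) ->
  transports (prod_prob Q) (prod_prob Q') (fun (x : dprod S) i => h i (x i)).
Proof.
move=> hQ.
have mH : measurable_fun setT ((fun x i => h i (x i)) : dprod S -> dprod S').
  apply/measurable_fun_dprodP => i.
  exact: (measurableT_comp (hQ i).1 ((jointly_generating_dprod S).1 i)).
split=> // U mU.
pose X : {mfun dprod S >-> dprod S'} := mfun_Sub (mem_set mH).
refine (eq_prob_box (jointly_generating_dprod S')
  (m1 := distribution (prod_prob Q) X) (m2 := prod_prob Q') _ mU) => C mC.
have mhC i : measurable (h i @^-1` C i).
  by rewrite -[X in measurable X]setTI; exact: (hQ i).1.
rewrite (prod_probE _ mC); apply: (etrans (prod_probE Q mhC)).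
by apply: eq_bigr => i _; exact: (hQ i).2.
Qed.

(** * The two estimators *)

Section partially_factorized_simulation.
Context (R : realType) (K : nat) dT (Theta : measurableType dT)
  (dS : 'I_K -> measure_display) (S : forall k, measurableType (dS k))
  (mu0 : probability Theta R) (Mk : forall k, R.-pker Theta ~> S k)
  (mu : probability (Theta * dprod S)%type R)
  (hmu : partially_factorized mu0 Mk mu)
  (phi : Theta * dprod S -> R)
  (mphi : measurable_fun setT phi)
  (phi_sq : mu.-integrable setT (fun z => (phi z ^+ 2)%:E))
  (phi_def : partial_integrals_defined Mk (EFin \o phi))
  (N : nat) (dO : measure_display) (Omega : measurableType dO)
  (P : probability Omega R)
  (W : nat -> {RV P >-> sample_space Theta S N.+1})
  (hW : sampling_scheme mu0 Mk W).

Local Notation sample := (sample_space Theta S N.+1).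
Local Notation idx := {ffun 'I_K -> 'I_N.+1}.
Local Notation iid t := (prod_prob (fun _ : 'I_N.+1 => Mprod Mk t)).
Local Notation m := (fine 'E_mu[phi]).

Definition draw_law (i : nat) : probability sample R := distribution P (W i).

Lemma draw_lawP i : disintegrates mu0 (fun t => iid t) (draw_law i).
Proof. exact: hW.2. Qed.

Let miid := measurable_iid Mk (L := 'I_N.+1).

(** The same shift for every theta, so that it preserves the joint law of
    theta and the copies. *)
Definition shift_sample (s : idx) (z : sample) : sample := (z.1, shift_copies s z.2).

Lemma transports_shift_sample s i :
  transports (draw_law i) (draw_law i) (shift_sample s).
Proof.
apply: (transports_fiber miid miid (draw_lawP i) (draw_lawP i)) => [|t].
  exact: measurable_select.
exact: transports_shift_copies.
Qed.

Lemma transports_draw_entry i (n : 'I_N.+1) :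
  transports (draw_law i) mu (fun z : sample => (z.1, z.2 n)).
Proof.
apply: (transports_fiber miid (measurable_Mprod Mk) (draw_lawP i) hmu
  (h := fun x : dprod (fun _ : 'I_N.+1 => dprod S) => x n)) => [|t].
  exact: (jointly_generating_dprod (fun _ : 'I_N.+1 => dprod S)).1.
exact: (transports_coordinate (fun _ : 'I_N.+1 => Mprod Mk t)).
Qed.

Lemma phi_integrable : mu.-integrable setT (EFin \o phi).
Proof. exact: integrable_sqr. Qed.

Lemma mean_phiE : 'E_mu[phi] = m%:E.
Proof.
rewrite fineK// expectation.unlock; apply: integrable_fin_num => //.
exact: phi_integrable.
Qed.

Lemma sqr_given_lty : \int[mu0]_t sqr_given Mk phi t < +oo.
Proof.
rewrite -(integral_disintegrates (measurable_Mprod Mk) hmu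
  (f := fun z => (phi z ^+ 2)%:E)).
- have /integrableP[_] := phi_sq.
  by under eq_integral do rewrite gee0_abs ?lee_fin ?sqr_ge0//.
- by apply/measurable_EFinP; exact: measurable_funX.
- by move=> z; rewrite lee_fin sqr_ge0.
Qed.

(** The error of the standard estimator for M draws is the mean of M independent copies
    of this one. *)
Definition std_error (z : sample) : R :=
  (std_avg (fun x => phi (z.1, x)) z.2 - m)%R.

Lemma measurable_std_error : measurable_fun setT std_error.
Proof.
apply: measurable_funB => //; apply: measurable_funM => //.
by apply: measurable_sum => n; exact: measurable_phi_entry.
Qed.

Lemma integral_std_error_sqr i : \int[draw_law i]_z (std_error z ^+ 2)%:E =
  \int[mu0]_t std_energy_given Mk phi N m t.
Proof.
rewrite (integral_disintegrates miid (draw_lawP i)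
  (f := fun z => (std_error z ^+ 2)%:E))//.
  by apply/measurable_EFinP; apply: measurable_funX; exact: measurable_std_error.
by move=> z; rewrite lee_fin sqr_ge0.
Qed.

Lemma std_error_sqr_integrable i :
  (draw_law i).-integrable setT (fun z => (std_error z ^+ 2)%:E).
Proof.
apply/integrableP; split.
  by apply/measurable_EFinP; apply: measurable_funX; exact: measurable_std_error.
under eq_integral do rewrite gee0_abs ?lee_fin ?sqr_ge0//.
rewrite integral_std_error_sqr.
have /integrableP[_] := std_energy_given_integrable mphi N m sqr_given_lty.
by under eq_integral do rewrite gee0_abs ?std_energy_given_ge0//.
Qed.

Lemma integral_std_error i : \int[draw_law i]_z (std_error z)%:E = 0.
Proof.
have ip n : (draw_law i).-integrable setT (fun z : sample => (phi (z.1, z.2 n))%:E).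
  exact: (integrable_transports (transports_draw_entry i n) phi_integrable).
have isum : (draw_law i).-integrable setT
    (fun z : sample => \sum_(n < N.+1) (phi (z.1, z.2 n))%:E).
  by apply: integrable_sum => // n _; exact: ip.
have ic : (draw_law i).-integrable setT (fun z : sample => m%:E : \bar R).
  exact: finite_measure_integrable_cst.
have iZ := integrableZl measurableT (N.+1%:R^-1) isum.
rewrite (_ : (fun z => _) = (fun z : sample =>
    (N.+1%:R^-1)%:E * \sum_(n < N.+1) (phi (z.1, z.2 n))%:E - m%:E)); last first.
  by apply/funext => z; rewrite sumEFin -EFinM -EFinB.
rewrite (integralB measurableT iZ ic) (integralZl measurableT isum).
rewrite (integral_sum measurableT ip) (eq_bigr (fun=> m%:E)); last first.
  move=> n _; rewrite -mean_phiE expectation.unlock.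
  exact: (integral_transports (transports_draw_entry i n) phi_integrable).
have := expectation_cst (draw_law i) m; rewrite unlock => ->.
rewrite sumr_const card_ord -[X in _ * X]mule_natl muleA -EFinM mulVf ?pnatr_eq0//.
by rewrite mul1r subee.
Qed.

Section comparison.
Variable M : nat.
Local Notation draws := (dprod (fun _ : 'I_M => sample)).
Local Notation joint := (prod_prob (fun i : 'I_M => draw_law i)).

Definition std_estimate (x : draws) : R :=
  ((M * N.+1)%:R^-1 * \sum_(i < M) \sum_(n < N.+1) phi ((x i).1, (x i).2 n))%R.

Lemma std_estimate_integrable : joint.-integrable setT (EFin \o std_estimate).
Proof.
rewrite (_ : _ \o _ = (fun x : draws => (M * N.+1)%:R^-1%:E *
    \sum_(i < M) \sum_(n < N.+1) (phi ((x i).1, (x i).2 n))%:E)); last first.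
  apply/funext => x; rewrite /= EFinM -sumEFin; congr (_ * _).
  by apply: eq_bigr => i _; rewrite sumEFin.
have ip i n : joint.-integrable setT (fun x : draws => (phi ((x i).1, (x i).2 n))%:E).
  have ie : (draw_law i).-integrable setT (fun z : sample => (phi (z.1, z.2 n))%:E).
    exact: (integrable_transports (transports_draw_entry i n) phi_integrable).
  exact: (integrable_transports (transports_coordinate (fun i : 'I_M => draw_law i) i) ie).
apply: integrableZl => //; apply: integrable_sum => // i _.
by apply: integrable_sum => // n _; exact: ip.
Qed.

Definition shift_draws (s : idx) (x : draws) : draws := fun i => shift_sample s (x i).

Lemma transports_shift_draws s : transports joint joint (shift_draws s).
Proof.
apply: (transports_prod_prob (h := fun _ : 'I_M => shift_sample s)) => i.
exact: transports_shift_sample.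
Qed.

(** Under the joint law of the M draws, the crossed estimator is the
    mean over s of the standard one after the shift s of all the draws. *)
Lemma variance_cross_le : 'V_P[mu_cross W phi M] <= 'V_P[mu_std W phi M].
Proof.
have tr : transports P joint (@first_draws _ _ _ _ _ _ W M).
  exact: (transports_first_draws hW.1 M).
pose cross x := (#|idx|%:R^-1 * \sum_s std_estimate (shift_draws s x))%R.
have crossE : mu_cross W phi M = cross \o (@first_draws _ _ _ _ _ _ W M).
  apply/funext => w; rewrite /mu_cross /cross/=.
  transitivity (M%:R^-1 * \sum_(i < M)
      cross_avg (fun y => phi ((W i w).1, y)) (W i w).2)%R.
    by rewrite /cross_avg -mulr_sumr natrM invfM -mulrA.
  rewrite (eq_bigr _ (fun (i : 'I_M) _ =>
    cross_avg_shift (fun y => phi ((W i w).1, y)) (W i w).2)).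
  rewrite -mulr_sumr exchange_big/= mulrCA; congr (_ * _)%R.
  rewrite mulr_sumr; apply: eq_bigr => s _.
  by rewrite /std_estimate natrM invfM -mulrA /std_avg -mulr_sumr.
have icross : joint.-integrable setT (EFin \o cross).
  have is_ s := integrable_transports (transports_shift_draws s) std_estimate_integrable.
  rewrite (_ : _ \o _ = (fun x : draws => (#|idx|%:R^-1)%:E *
      \sum_s (std_estimate (shift_draws s x))%:E)); last first.
    by apply/funext => x; rewrite /= EFinM -sumEFin.
  by apply: integrableZl => //; apply: integrable_sum => // s _; exact: is_.
rewrite crossE (variance_transports tr icross).
rewrite [leRHS](_ : _ = 'V_joint[std_estimate]).
  apply: variance_average_le.
  - exact: transports_shift_draws.
  - by rewrite card_ffun !card_ord expn_gt0.
  - exact: std_estimate_integrable.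
exact: (variance_transports tr std_estimate_integrable).
Qed.

End comparison.

Lemma sigma2_cross_le : sigma2_cross mu0 Mk mu N.+1 phi <=
  \int[draw_law 0]_z (std_error z ^+ 2)%:E.
Proof.
rewrite integral_std_error_sqr.
have := integral_anova_given_le mphi phi_def N m sqr_given_lty.
by rewrite /bias_given -mean_phiE.
Qed.

(** A law is determined by its disintegration, so all the draws
    have the same one. *)
Lemma sqnorm_charfun_draw_law i (f : sample -> R) : measurable_fun setT f ->
  sqnorm_charfun (draw_law i) f = sqnorm_charfun (draw_law 0) f.
Proof.
move=> mf; apply: (sqnorm_charfun_transports (h := id)) mf.
by split=> // U mU; exact: (disintegrates_unique miid (draw_lawP i) (draw_lawP 0)).
Qed.

(** Convergence in law is used for the test functions
    x |-> cos(t x) only. *)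
Lemma std_error_variance_le (s2 : R) :
  asymptotic_variance P (mu_std W phi) m s2 ->
  \int[draw_law 0]_z (std_error z ^+ 2)%:E <= s2%:E.
Proof.
move=> [s20 clt]; have me := measurable_std_error.
have e2 := std_error_sqr_integrable 0; have e1 := integral_std_error 0.
have vfin := integrable_fin_num measurableT e2.
rewrite -(fineK vfin) lee_fin.
apply: le_of_gaussian_bound => //.
  by apply: fine_ge0; apply: integral_ge0 => z _; rewrite lee_fin sqr_ge0.
move=> t.
pose g (x : R) := cos (t * x)%R.
have cg : continuous g.
  move=> x; apply: continuous_comp; last exact: continuous_cos.
  exact: mulrl_continuous.
have bg : exists C : R, forall x, (`|g x| <= C)%R by exists 1%R => x; exact: cos_max.
have cv := clt g cg bg.
have ge := gaussian_cos_ge t s20.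
have lfin : \int[gaussian s2]_x (g x)%:E \is a fin_num.
  apply: integrable_fin_num => //; apply: integrable_cos.
  exact: measurable_funM.
exists (fine (\int[gaussian s2]_x (g x)%:E)).
  by rewrite -lee_fin (fineK lfin).
apply: (@sqnorm_charfun_power_limit _ _ _ (draw_law 0) std_error me e2 e1 t
  (fun M => fine 'E_P[fun w => g (Num.sqrt M%:R * (mu_std W phi M w - m))%R])).
  by apply: fine_cvg; rewrite (fineK lfin).
move=> M.
pose scaled (z : sample) : R := (t * std_error z / Num.sqrt M%:R)%R.
have mscaled : measurable_fun setT scaled.
  by apply: measurable_funM => //; exact: measurable_funM.
rewrite (_ : (_ ^+ M)%R =
    sqnorm_charfun P (fun w => \sum_(i < M) scaled (W i w))%R); last first.
  rewrite (sqnorm_charfun_sum_draws hW.1 M mscaled).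
  rewrite (eq_bigr (fun=> sqnorm_charfun (draw_law 0) scaled)).
    by rewrite prodr_const card_ord.
  by move=> i _; exact: sqnorm_charfun_draw_law.
rewrite (_ : (fun w => _) =
    (fun w => cos (\sum_(i < M) scaled (W i w)))%R); last first.
  apply/funext => w; congr cos; rewrite /scaled /std_error /mu_std /std_avg.
  rewrite -mulr_suml -mulr_sumr sumrB -mulr_sumr sumr_const card_ord -(mulr_natl m).
  move: (\sum_(i < M) _)%R => q; move: m => c.
  have [->|M0] := eqVneq M 0%N; first by rewrite sqrtr0 mul0r invr0 !mulr0.
  have s0 : (Num.sqrt M%:R != 0 :> R)%R by rewrite gt_eqF// sqrtr_gt0 ltr0n lt0n.
  have sM : (M%:R = Num.sqrt M%:R ^+ 2 :> R)%R by rewrite sqr_sqrtr.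
  have N0 : (N.+1%:R != 0 :> R)%R by rewrite pnatr_eq0.
  rewrite natrM; move: (Num.sqrt M%:R) sM s0 (N.+1%:R)%R N0 => a -> a0 b b0.
  by field; rewrite a0 b0.
(* The real part is at most the modulus. *)
rewrite /sqnorm_charfun expectation.unlock -[leLHS]/(_ ^+ 2)%R.
by rewrite lerDl sqr_ge0.
Qed.

End partially_factorized_simulation.

Theorem corollary4 (R : realType) (K : nat) (hK : (1 < K)%N)
  (dT : measure_display) (Theta : measurableType dT)
  (dS : 'I_K -> measure_display) (S : forall k : 'I_K, measurableType (dS k))
  (mu0 : probability Theta R) (Mk : forall k : 'I_K, R.-pker Theta ~> S k)
  (mu : probability (Theta * dprod S)%type R)
  (hmu : partially_factorized mu0 Mk mu)
  (phi : Theta * dprod S -> R)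
  (phi_L2 : phi \in Lfun mu 2%:E)
  (phi_def : partial_integrals_defined Mk (EFin \o phi))
  (N : nat) (hN : (0 < N)%N)
  (dO : measure_display) (Omega : measurableType dO) (P : probability Omega R)
  (W : nat -> {RV P >-> sample_space Theta S N})
  (hW : sampling_scheme mu0 Mk W) :
  (forall M : nat, (0 < M)%N ->
     'V_P[mu_cross W phi M] <= 'V_P[mu_std W phi M]) /\
  (forall sigma2_N : R,
     asymptotic_variance P (mu_std W phi) (fine 'E_mu[phi]) sigma2_N ->
     sigma2_cross mu0 Mk mu N phi <= sigma2_N%:E).
Proof.
have mphi : measurable_fun setT phi.
  by move: phi_L2; rewrite inE => /andP[]; rewrite inE.
have phi_sq := Lfun2_integrable_sqr phi_L2.
case: N hN W hW => // {}N _ W hW; split=> [M _|s2 hs2].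
  exact: (variance_cross_le hmu mphi phi_sq hW).
apply: (le_trans (sigma2_cross_le hmu mphi phi_sq phi_def hW)).
exact: (std_error_variance_le hmu mphi phi_sq hW hs2).
Qed.
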